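(* (Asymptotic upper matching conjecture.) Let $d\ge 1$ be an integer and let $\mathcal G_d=(G_n)_{n\in N}$ be an infinite sequence of finite simple $d$-regular graphs, indexed by an infinite set $N$ of positive integers, where $G_n$ has $n$ vertices. For $\rho\in[0,1/2]$ define \[ h_{\mathcal G_d}(\rho)=\sup_{\{k_n\}}\ \limsup_{n\to\infty,\ n\in N}\frac{\log m_{k_n}(G_n)}{n}, \] where the supremum is over all sequences $\{k_n\}_{n\in N}$ of nonnegative integers with $k_n/n\to\rho$, and define \[ h_d(\rho)=\lim_{n\to\infty,\ 2d\mid n}\frac{\log m_{\lfloor\rho n\rfloor}(H_{d,n})}{n}. \] Then for every such sequence $\mathcal G_d$ and every $\rho\in[0,1/2]$, \[ h_{\mathcal G_d}(\rho)\le h_d(\rho). \]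
   Context: For a finite graph $G$, $m_k(G)$ denotes the number of matchings of $G$ with exactly $k$ edges (so $m_0(G)=1$). The convention $\log 0=-\infty$ is used. When $2d$ divides $n$, $H_{d,n}$ denotes the $d$-regular $n$-vertex graph that is the disjoint union of $n/(2d)$ copies of the complete bipartite graph $K_{d,d}$. *)

(* Defs.v *)
From HB Require Import structures.
From mathcomp Require Import all_boot all_order all_algebra.
From mathcomp Require Import all_classical all_reals all_analysis.
Import Order.TTheory GRing.Theory Num.Theory.
Import numFieldNormedType.Exports.
Set Implicit Arguments.
Unset Strict Implicit.
Unset Printing Implicit Defensive.

Record sgraph := SGraph {
  vertex :> finType;
  adj : rel vertex;
  adj_sym : symmetric adj;
  adj_irrefl : irreflexive adj }.

Definition regular (d : nat) (G : sgraph) : Prop :=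
  forall x : G, #|[set y | adj x y]| = d.

Definition edges (G : sgraph) : {set {set G}} :=
  [set [set p.1; p.2] | p : G * G & adj p.1 p.2].

(* A set of edges is a matching when no two of its members share a vertex. *)
Definition matching (G : sgraph) (M : {set {set G}}) : bool :=
  (M \subset edges G) && finset.trivIset M.

Definition num_matchings (k : nat) (G : sgraph) : nat :=
  #|[set M : {set {set G}} | matching M && (#|M| == k)]|.

Definition complete_bipartite_adj (d : nat) : rel (bool * 'I_d) :=
  fun x y => x.1 != y.1.

Lemma complete_bipartite_sym d : symmetric (@complete_bipartite_adj d).
Proof. by move=> x y; rewrite /complete_bipartite_adj eq_sym. Qed.

Lemma complete_bipartite_irrefl d : irreflexive (@complete_bipartite_adj d).
Proof. by move=> x; rewrite /complete_bipartite_adj eqxx. Qed.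

(* K_{d,d}; the boolean component tells the two sides apart. *)
Definition complete_bipartite (d : nat) : sgraph :=
  SGraph (@complete_bipartite_sym d) (@complete_bipartite_irrefl d).

Definition copies_adj (q : nat) (G : sgraph) : rel ('I_q * G) :=
  fun x y => (x.1 == y.1) && adj x.2 y.2.

Lemma copies_sym q G : symmetric (@copies_adj q G).
Proof. by move=> x y; rewrite /copies_adj eq_sym adj_sym. Qed.

Lemma copies_irrefl q G : irreflexive (@copies_adj q G).
Proof. by move=> x; rewrite /copies_adj adj_irrefl andbF. Qed.

Definition copies (q : nat) (G : sgraph) : sgraph :=
  SGraph (@copies_sym q G) (@copies_irrefl q G).

(* H_{d,n}. When 2d divides n it is d-regular on n vertices; other values of n are never used. *)
Definition bipartite_union (d n : nat) : sgraph :=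
  copies (n %/ (2 * d)) (complete_bipartite d).

Local Open Scope classical_set_scope.
Local Open Scope ring_scope.
Local Open Scope ereal_scope.

(* (log m_k(G)) / n as an extended real; [lne 0 = -oo]. *)
Definition matching_rate (R : realType) (n k : nat) (G : sgraph) : \bar R :=
  lne (num_matchings k G)%:R%:E * (n%:R^-1)%:E.

(* Limits as n -> oo with n restricted to a set A are taken along
   [within A \oo], so the values of G and k outside A are irrelevant. *)
Definition upper_entropy (R : realType) (N : set nat) (G : nat -> sgraph)
    (rho : R) : \bar R :=
  ereal_sup [set limf_esup (fun n => matching_rate R n (k n) (G n))
                           (within N \oo)
            | k in [set k : nat -> nat |
                     ((k n)%:R / n%:R : R)%R @[n --> within N \oo] --> rho]].

(* For rho >= 0, [Num.truncn (rho * n)] is the floor of rho * n. *)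
Definition bipartite_rate (R : realType) (d : nat) (rho : R) (n : nat) : \bar R :=
  matching_rate R n (Num.truncn (rho * n%:R)%R) (bipartite_union d n).

Definition bipartite_filter (d : nat) : set_system nat :=
  within [set n | (2 * d %| n)%N] \oo.

Definition bipartite_entropy (R : realType) (d : nat) (rho : R) : \bar R :=
  lim (bipartite_rate d rho n @[n --> bipartite_filter d]).

(* Main.v *)
Require Import Defs.
From HB Require Import structures.
From mathcomp Require Import all_boot all_order all_algebra.
From mathcomp Require Import all_classical all_reals all_analysis.
From mathcomp Require Import ring lra zify.
Import Order.TTheory GRing.Theory Num.Theory.
Import numFieldNormedType.Exports.

(** Let M be drawn with weight l^|M|.  For an uncovered vertex u let x(u) be
    the number of its uncovered neighbours.  Deleting a matching edge at a
    covered neighbour of u shows, for every nondecreasing b,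
      sum_M l^|M| sum_u [(d - x) b(x) - l x (x - 1) b(x - 1)] <= 0,
    the inequality being a rearrangement over uncovered edges; it is tight for
    unions of K_{d,d}, where x takes the same value at both ends of an
    uncovered edge.  Choosing b to solve the Poisson equation
    (d - x) b(x) - l x (x - 1) b(x - 1) = x - c bounds the mean of x by c, which
    bounds the logarithmic derivative of the matching polynomial of any
    d-regular graph by that of K_{d,d}, so M_G(l)^(2d) <= M_{K_{d,d}}(l)^n.
    Since m_k l^k <= M_G(l), the upper entropy is at most
    log M_{K_{d,d}}(l) / (2d) - rho log l for every l > 0.  For 0 < rho < 1/2,
    at the l for which the mean matching density is rho, Chebyshev's inequality
    shows that unions of K_{d,d} attain this value; the endpoints are the
    limits l -> 0 and l -> oo. *)

Set Implicit Arguments.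
Unset Strict Implicit.
Unset Printing Implicit Defensive.
Local Open Scope ring_scope.

(** * Matchings and uncovered vertices *)

Definition uncovered (G : sgraph) (M : {set {set G}}) : {set G} :=
  [set v | v \notin finset.cover M]%SET.

Definition free_degree (G : sgraph) (M : {set {set G}}) (u : G) : nat :=
  #|[set v in uncovered M | adj u v]%SET|.

Lemma mem_edges (G : sgraph) (v w : G) : ([set v; w]%SET \in edges G) = adj v w.
Proof.
apply/imsetP/idP => [[[a b]] /= ab E|vw]; last by exists (v, w); rewrite ?inE.
have av : a \in [set v; w]%SET by rewrite E set21.
have bv : b \in [set v; w]%SET by rewrite E set22.
move: ab; rewrite inE /=.
case/set2P: av => ->; case/set2P: bv => ->; rewrite ?adj_irrefl // => h.
by rewrite adj_sym.
Qed.

Lemma edge_card (G : sgraph) (e : {set G}) : e \in edges G -> #|e| = 2%N.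
Proof.
case/imsetP => -[a b]; rewrite inE /= => ab ->.
by rewrite cards2; case: eqVneq ab => //= ->; rewrite adj_irrefl.
Qed.

Lemma edge_mate (G : sgraph) (e : {set G}) (v : G) :
  e \in edges G -> v \in e -> exists w, e = [set v; w]%SET.
Proof.
case/imsetP => -[a b] _ -> /set2P [] ->; first by exists b.
by exists a; rewrite /= finset.setUC.
Qed.

Lemma matching_edge (G : sgraph) (M : {set {set G}}) (e : {set G}) :
  matching M -> e \in M -> e \in edges G.
Proof. by case/andP => /fintype.subsetP sM _; apply: sM. Qed.

Lemma matching_adj (G : sgraph) (M : {set {set G}}) (v w : G) :
  matching M -> [set v; w]%SET \in M -> adj v w.
Proof. by move=> mM vw; rewrite -mem_edges (matching_edge mM). Qed.

Lemma mate_uniq (G : sgraph) (M : {set {set G}}) (v w w' : G) :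
  matching M -> [set v; w]%SET \in M -> [set v; w']%SET \in M -> w = w'.
Proof.
move=> mM h h'; have /andP[_ tM] := mM.
have E : [set v; w]%SET = [set v; w']%SET.
  by rewrite -(def_pblock tM h (set21 v w)) (def_pblock tM h' (set21 v w')).
have : w \in [set v; w']%SET by rewrite -E set22.
case/set2P => // wv; move: (matching_adj mM h).
by rewrite wv adj_irrefl.
Qed.

(** A covered vertex has exactly one mate and an uncovered one has none. This turns sums over
    covered vertices into sums over oriented matching edges, the form on which [edge_switch]
    acts. *)
Lemma sum_mates (G : sgraph) (V : nmodType) (M : {set {set G}}) (v : G) (c : V) :
  matching M ->
  \sum_(w | [set v; w]%SET \in M) c = if v \in uncovered M then 0 else c.
Proof.
move=> mM; rewrite inE; case: ifPn => [vM|].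
  rewrite big1 // => w vw; case/negP: vM; apply/bigcupP.
  by exists [set v; w]%SET => //; rewrite set21.
rewrite negbK => /bigcupP[e eM ve].
have [w Ew] := edge_mate (matching_edge mM eM) ve; subst e.
rewrite (big_pred1 w) // => w' /=; apply/idP/eqP => [h|-> //].
exact: mate_uniq mM h eM.
Qed.

Lemma card_cover_matching (G : sgraph) (M : {set {set G}}) :
  matching M -> #|finset.cover M| = (2 * #|M|)%N.
Proof.
move=> mM; have /andP[_ /eqP <-] := mM.
rewrite (eq_bigr (fun=> 2%N)) ?sum_nat_const 1?mulnC // => e eM.
exact: edge_card (matching_edge mM eM).
Qed.

Lemma card_uncovered (G : sgraph) (M : {set {set G}}) :
  matching M -> (#|uncovered M| + 2 * #|M| = #|G|)%N.
Proof.
move=> mM; rewrite -card_cover_matching // addnC -(cardsC (finset.cover M)).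
by congr (_ + #|pred_of_set _|)%N; apply/setP => v; rewrite !inE.
Qed.

Lemma sum_pairs_matching (G : sgraph) (M : {set {set G}}) :
  matching M -> (\sum_v \sum_(w | [set v; w]%SET \in M) 1 = 2 * #|M|)%N.
Proof.
move=> mM; rewrite -card_cover_matching // -sum1_card [RHS]big_mkcond /=.
apply: eq_bigr => v _; rewrite (sum_mates v 1%N mM) inE.
by case: (v \in finset.cover M).
Qed.

Lemma cover_add_edge (G : sgraph) (M : {set {set G}}) (e : {set G}) :
  finset.cover (e |: M)%SET = (e :|: finset.cover M)%SET.
Proof. by rewrite /finset.cover finset.bigcup_setU finset.big_set1. Qed.

Lemma mem_uncovered_add (G : sgraph) (M : {set {set G}}) (u v w : G) :
  (u \in uncovered ([set v; w] |: M)%SET) =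
  [&& u != v, u != w & u \in uncovered M].
Proof. by rewrite !inE cover_add_edge !inE !negb_or andbA. Qed.

(** Shaped as the side condition of [reindex_onto]: the equation with [M] encodes that the edge is
    not already in [M]. *)
Lemma matching_add_edge (G : sgraph) (M : {set {set G}}) (v w : G) :
  adj v w ->
  matching ([set v; w] |: M)%SET && ((([set v; w] |: M) :\ [set v; w])%SET == M) =
  [&& matching M, v \in uncovered M & w \in uncovered M].
Proof.
move=> vw; set e := [set v; w]%SET; apply/andP/and3P => [[me /eqP E]|[mM vM wM]].
  have /andP[se te] := me; have ee : e \in (e |: M)%SET by rewrite finset.setU11.
  have cE : finset.cover M = (finset.cover (e |: M) :\: e)%SET.
    by rewrite -{1}E coverD1.
  split; last 2 first.
  - by rewrite inE cE !inE eqxx.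
  - by rewrite inE cE !inE eqxx orbT.
  apply/andP; split; first exact: fintype.subset_trans (finset.subsetUr _ _) se.
  exact: finset.trivIsetS (finset.subsetUr _ _) te.
have eM : e \notin M.
  apply/negP => eM; move: vM; rewrite inE => /negP; apply; apply/bigcupP.
  by exists e => //; rewrite set21.
split; last by rewrite finset.setU1K.
have /andP[sM tM] := mM; apply/andP; split.
  by rewrite finset.subUset finset.sub1set mem_edges vw sM.
have dM B : B \in M -> [disjoint e & B].
  move=> BM; rewrite disjoint_sym disjoint_subset; apply/fintype.subsetP => x xB.
  rewrite !inE; apply/norP; split; apply/eqP => xE; subst x.
    by move: vM; rewrite inE => /bigcupP; apply; exists B.
  by move: wM; rewrite inE => /bigcupP; apply; exists B.
have s0 : finset.set0 \notin M.
  by apply/negP => /(matching_edge mM)/edge_card; rewrite cards0.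
by have [] := finset.trivIsetU1 dM tM s0.
Qed.

(* Deleting the edge [vw] is a bijection from pairs (matching, oriented edge
   in it) onto pairs (matching, oriented edge it leaves uncovered). *)
Lemma edge_switch (G : sgraph) (V : nmodType) (phi : {set {set G}} -> G -> G -> V) :
  \sum_(M | matching M) \sum_v \sum_(w | [set v; w]%SET \in M) phi M v w =
  \sum_(M | matching M) \sum_(v in uncovered M)
    \sum_(w in uncovered M | adj v w) phi ([set v; w] |: M)%SET v w.
Proof.
(* Both sides are rearranged with the oriented edge outermost; for a fixed edge, adding it is a
   bijection on matchings. *)
pose T := \sum_v \sum_(w | adj v w) \sum_(M | matching M && ([set v; w]%SET \in M)) phi M v w.
transitivity T.
  rewrite exchange_big; apply: eq_bigr => v _ /=.
  rewrite (exchange_big_dep (fun w => adj v w)) /=.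
    by [].
  by move=> M w; apply: matching_adj.
rewrite /T.
transitivity (\sum_v \sum_(w | adj v w)
   \sum_(M | [&& matching M, v \in uncovered M & w \in uncovered M])
   phi ([set v; w] |: M)%SET v w).
  apply: eq_bigr => v _; apply: eq_bigr => w vw.
  rewrite (reindex_onto (fun M => [set v; w] |: M)%SET
    (fun M => M :\ [set v; w])%SET) /=; last first.
    by move=> M /andP[_ vwM]; rewrite finset.setD1K.
  by apply: eq_bigl => M; rewrite finset.setU11 andbT matching_add_edge.
rewrite [RHS](exchange_big_dep xpredT) //=; apply: eq_bigr => v _.
rewrite [RHS](exchange_big_dep (fun w => adj v w)) /=; last by move=> M w _ /andP[].
apply: eq_bigr => w vw; apply: eq_bigl => M.
by rewrite vw andbT -andbA.
Qed.

(** * Free degrees under edge switching *)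

Lemma sum_free_degree (G : sgraph) (V : nmodType) (M : {set {set G}}) (u : G) (c : V) :
  \sum_(v in uncovered M | adj u v) c = c *+ free_degree M u.
Proof. by rewrite -sumr_const; apply: eq_bigl => v; rewrite inE. Qed.

Lemma free_degree_le (d : nat) (G : sgraph) (M : {set {set G}}) (u : G) :
  regular d G -> (free_degree M u <= d)%N.
Proof.
move=> rG; rewrite -(rG u); apply: subset_leq_card.
by apply/fintype.subsetP => v; rewrite !inE => /andP[].
Qed.

(** By regularity, the rate [d - x] of the Poisson equation counts the covered neighbours of [u]. *)
Lemma sum_covered_neighbors (d : nat) (G : sgraph) (V : nmodType)
    (M : {set {set G}}) (u : G) (c : V) :
  regular d G ->
  \sum_(v | adj u v) (if v \in uncovered M then 0 else c) =
  c *+ (d - free_degree M u).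
Proof.
move=> rG; have -> : (d - free_degree M u)%N =
    #|[set v | (v \notin uncovered M) && adj u v]%SET|.
  rewrite -(rG u) /free_degree.
  rewrite -(cardsID (uncovered M) [set v | adj u v]%SET).
  have -> : ([set v | adj u v] :&: uncovered M)%SET = [set v in uncovered M | adj u v]%SET.
    by apply/setP => v; rewrite !inE andbC.
  rewrite addKn; congr #|pred_of_set _|; apply/setP => v; rewrite !inE.
  by [].
rewrite -sumr_const (bigID (fun v => v \in uncovered M)) /=.
rewrite big1 ?add0r; last by move=> v /andP[_ ->].
apply: eq_big => [v|v /andP[_ /negPf -> //]]; by rewrite [RHS]inE andbC.
Qed.

(** Covering [v] and [w] costs [u] the free neighbour [v], and also [w] when the three form a
    triangle. The truncated subtractions are exact, since the removed vertices were counted. *)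
Lemma free_degree_add (G : sgraph) (M : {set {set G}}) (u v w : G) :
  v \in uncovered M -> w \in uncovered M -> adj u v -> adj v w ->
  free_degree ([set v; w] |: M)%SET u = (free_degree M u - 1 - adj u w)%N.
Proof.
move=> vM wM uv vw.
have vw' : v != w by apply/eqP => E; move: vw; rewrite E adj_irrefl.
have -> : free_degree ([set v; w] |: M)%SET u =
  #|([set x in uncovered M | adj u x] :\ v :\ w)%SET|.
  apply: eq_card => x; rewrite inE mem_uncovered_add !inE.
  by case: (x == v); case: (x == w); rewrite //= ?andbF.
have vS : v \in [set x in uncovered M | adj u x]%SET by rewrite finset.in_set vM.
have := cardsD1 w ([set x in uncovered M | adj u x] :\ v)%SET.
have := cardsD1 v [set x in uncovered M | adj u x]%SET.
rewrite /free_degree vS in_setD1 (eq_sym w v) vw' finset.in_set wM /=.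
by lia.
Qed.

Lemma card_add_edge (G : sgraph) (M : {set {set G}}) (v w : G) :
  v \in uncovered M -> #|([set v; w] |: M)%SET| = #|M|.+1.
Proof.
move=> vM; rewrite cardsU1; have -> //= : [set v; w]%SET \notin M.
apply/negP => eM; move: vM; rewrite inE => /negP; apply; apply/bigcupP.
by exists [set v; w]%SET => //; rewrite set21.
Qed.

(** The factor [d - x] selects a covered neighbour [v] of [u]. Deleting the edge from [v] to its
    mate [w] frees both ends and lowers the size by one, whence the factor [l]. Since [w] was
    covered, [u] differs from it. *)
Lemma edge_switch_free_degree (R : comNzRingType) (d : nat) (G : sgraph) (l : R)
    (b : nat -> R) :
  regular d G ->
  \sum_(M : {set {set G}} | matching M) l ^+ #|M| *
    (\sum_(u in uncovered M) (d - free_degree M u)%:R * b (free_degree M u)) =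
  l * \sum_(M : {set {set G}} | matching M) l ^+ #|M| *
    (\sum_(v in uncovered M) \sum_(w in uncovered M | adj v w)
      \sum_(u in uncovered M | (u != w) && adj u v)
        b (free_degree M u - 1 - adj u w)%N).
Proof.
move=> rG.
pose phi (M : {set {set G}}) (v w : G) :=
  l ^+ #|M| * (\sum_(u in uncovered M | adj u v) b (free_degree M u)).
transitivity (\sum_(M : {set {set G}} | matching M)
    \sum_v \sum_(w | [set v; w]%SET \in M) phi M v w).
  apply: eq_bigr => M mM.
  under [RHS]eq_bigr => v _ do rewrite sum_mates //.
  rewrite mulr_sumr /phi.
  transitivity (\sum_(u in uncovered M) \sum_(v | adj u v)
     if v \in uncovered M then 0 else l ^+ #|M| * b (free_degree M u)).
    apply: eq_bigr => u _; rewrite (sum_covered_neighbors _ _ _ rG).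
    by rewrite mulr_natl mulrnAr.
  rewrite (exchange_big_dep xpredT) //=; apply: eq_bigr => v _.
  case: ifP => vM; first by rewrite big1.
  by rewrite -mulr_sumr; congr (_ * _); apply: eq_bigl.
rewrite edge_switch mulr_sumr; apply: eq_bigr => M mM.
rewrite !mulr_sumr; apply: eq_bigr => v vM.
rewrite !mulr_sumr; apply: eq_bigr => w /andP[wM vw].
rewrite /phi card_add_edge // exprS mulrA; congr (_ * _).
rewrite [LHS]big_mkcond [RHS]big_mkcond; apply: eq_bigr => u _ /=.
rewrite mem_uncovered_add; case: (boolP (adj u v)) => [uv|_]; last by rewrite !andbF.
rewrite !andbT; have -> /= : u != v by apply: contraTneq uv => ->; rewrite adj_irrefl.
rewrite andbC; case: ifP => // _.
by rewrite free_degree_add.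
Qed.

(** The left side runs over free paths [u], [v], [w]; once [u] and [v] are fixed, [w] is any free
    neighbour of [v] other than [u]. *)
Lemma sum_free_paths (R : comNzRingType) (G : sgraph) (M : {set {set G}}) (b : nat -> R) :
  \sum_(v in uncovered M) \sum_(w in uncovered M | adj v w)
    \sum_(u in uncovered M | (u != w) && adj u v) b (free_degree M u - 1)%N =
  \sum_(u in uncovered M) \sum_(v in uncovered M | adj u v)
    (free_degree M v - 1)%:R * b (free_degree M u - 1)%N.
Proof.
rewrite [RHS](exchange_big_dep (mem (uncovered M))) /=; last by move=> u v _ /andP[].
apply: eq_bigr => v vM.
rewrite (exchange_big_dep (fun u => (u \in uncovered M) && adj u v)) /=; last first.
  by move=> w u _ /and3P[-> _ ->].
apply: eq_big => [u|u /andP[uM uv]]; first by rewrite vM.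
rewrite sumr_const mulr_natl; congr (_ *+ _).
have uS : u \in [set x in uncovered M | adj v x]%SET.
  by rewrite finset.in_set uM adj_sym.
rewrite /free_degree (cardsD1 u [set x in uncovered M | adj v x]%SET) uS add1n subn1 /=.
apply: eq_card => w; rewrite in_setD1 finset.in_set unfold_in /= uM uv andbT eq_sym.
by rewrite andbC.
Qed.

Lemma sum_free_square (R : comNzRingType) (G : sgraph) (M : {set {set G}}) (b : nat -> R) :
  \sum_(u in uncovered M) \sum_(v in uncovered M | adj u v)
    (free_degree M u - 1)%:R * b (free_degree M u - 1)%N =
  \sum_(u in uncovered M) (free_degree M u * (free_degree M u - 1))%:R
    * b (free_degree M u - 1)%N.
Proof.
by apply: eq_bigr => u _; rewrite sum_free_degree natrM -mulrA [RHS]mulr_natl.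
Qed.

(** This is [(n - m) (b n - b m) >= 0] expanded. *)
Lemma nondecreasing_rearrangement (R : realDomainType) (b : nat -> R) (m n : nat) :
  {homo b : i j / (i <= j)%N >-> i <= j} ->
  n%:R * b m + m%:R * b n <= m%:R * b m + n%:R * b n.
Proof.
move=> hb; have [mn|nm] := leqP m n.
  have h1 := hb _ _ mn; have h2 : (m%:R : R) <= n%:R by rewrite ler_nat.
  by nra.
have h1 := hb _ _ (ltnW nm); have h2 : (n%:R : R) <= m%:R by rewrite ler_nat ltnW.
by nra.
Qed.

(** Dropping the triangle correction can only raise the sum, as [b] is nondecreasing. The
    rearrangement inequality is then applied to the values [x - 1] at the two ends of each free
    edge. *)
Lemma sum_free_paths_le (R : realFieldType) (G : sgraph) (M : {set {set G}}) (b : nat -> R) :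
  {homo b : i j / (i <= j)%N >-> i <= j} ->
  \sum_(v in uncovered M) \sum_(w in uncovered M | adj v w)
    \sum_(u in uncovered M | (u != w) && adj u v)
      b (free_degree M u - 1 - adj u w)%N <=
  \sum_(u in uncovered M) (free_degree M u * (free_degree M u - 1))%:R
    * b (free_degree M u - 1)%N.
Proof.
move=> hb; rewrite -sum_free_square.
apply: (@le_trans _ _ (\sum_(u in uncovered M) \sum_(v in uncovered M | adj u v)
    (free_degree M v - 1)%:R * b (free_degree M u - 1)%N)).
  rewrite -sum_free_paths.
  apply: ler_sum => v _; apply: ler_sum => w _; apply: ler_sum => u _.
  by apply: hb; rewrite leq_subr.
have swap (F : G -> G -> R) :
    \sum_(u in uncovered M) \sum_(v in uncovered M | adj u v) F u v =
    \sum_(u in uncovered M) \sum_(v in uncovered M | adj u v) F v u.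
  rewrite (exchange_big_dep (mem (uncovered M))) /=; last by move=> u v _ /andP[].
  apply: eq_bigr => v vM; apply: eq_bigl => u; rewrite (vM : v \in uncovered M).
  by rewrite adj_sym.
(* Doubling both sides and reversing the edges in one copy groups [(u, v)] with [(v, u)]. *)
rewrite -(@ler_pM2l _ 2%:R) ?ltr0n // !mulr_natl !mulr2n {2}swap [in leRHS]swap.
rewrite [in X in _ <= _ + X]swap.
rewrite -!big_split /=; apply: ler_sum => u _.
rewrite -!big_split /=; apply: ler_sum => v _.
by rewrite [leRHS]addrC; apply: nondecreasing_rearrangement.
Qed.

(* The properties of disjoint unions of K_{d,d} that make every inequality
   in the argument tight. *)
Definition balanced (G : sgraph) : Prop :=
  [/\ forall u v w : G, adj u v -> adj v w -> ~~ adj u w,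
      forall (M : {set {set G}}) (u v : G), matching M -> u \in uncovered M ->
        v \in uncovered M -> adj u v -> free_degree M u = free_degree M v &
      forall (M : {set {set G}}) (u : G), matching M -> u \in uncovered M ->
        (0 < free_degree M u)%N].

(** Without triangles the correction vanishes, and equal free degrees at adjacent free vertices make
    the rearrangement an equality. *)
Lemma sum_free_paths_balanced (R : realFieldType) (G : sgraph) (M : {set {set G}})
    (b : nat -> R) :
  balanced G -> matching M ->
  \sum_(v in uncovered M) \sum_(w in uncovered M | adj v w)
    \sum_(u in uncovered M | (u != w) && adj u v)
      b (free_degree M u - 1 - adj u w)%N =
  \sum_(u in uncovered M) (free_degree M u * (free_degree M u - 1))%:R
    * b (free_degree M u - 1)%N.
Proof.
move=> [tri bal _] mM; rewrite -sum_free_square.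
transitivity (\sum_(u in uncovered M) \sum_(v in uncovered M | adj u v)
    (free_degree M v - 1)%:R * b (free_degree M u - 1)%N).
  rewrite -sum_free_paths.
  apply: eq_bigr => v _; apply: eq_bigr => w /andP[_ vw]; apply: eq_bigr => u.
  case/and3P => _ _ uv.
  by rewrite (negPf (tri _ _ _ uv vw)) subn0.
apply: eq_bigr => u uM; apply: eq_bigr => v /andP[vM uv].
by rewrite (bal M u v).
Qed.

(** * A Poisson equation *)

(** A discrete minimum principle, in the shifted variables [k = x - 1] and [m = d - 1]. At the least
    increment, the second difference of the recurrence bounds a positive multiple of that increment
    below by [- 2 l b(k)], which is nonnegative. *)
Lemma poisson_increment_nondecreasing (R : realFieldType) (m : nat) (l c : R) (b : nat -> R) :
  0 < l ->
  (forall k, (k <= m)%N ->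
     (m - k)%:R * b k - l * (k.+1 * k)%:R * b k.-1 = k.+1%:R - c) ->
  (forall k, (k < m)%N -> b k <= 0) ->
  forall k, (k.+1 < m)%N -> b k <= b k.+1.
Proof.
move=> l0 E b0 k0 k0m; rewrite -subr_ge0; have km : (k0 < m.-1)%N by lia.
pose D (i : 'I_m.-1) := b i.+1 - b i.
have [/= k _ kmin] := @arg_minP _ R _ (Ordinal km) xpredT D isT.
apply: le_trans (kmin (Ordinal km) isT); rewrite leNgt; apply/negP => Dneg.
have klt := ltn_ord k; have E0 := E k ltac:(lia); have E1 := E k.+1 ltac:(lia).
have E2 := E k.+2 ltac:(lia); have bk0 := b0 k ltac:(lia).
(* At [k + 2 = m] here, and at [k = 0] below, the neighbouring increment leaves the range of [D],
   but its coefficient is zero. *)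
have h2 : (m - k.+2)%:R * D k <= (m - k.+2)%:R * (b k.+2 - b k.+1).
  have [k2|k2] := ltnP k.+2 m; last first.
    have -> : (m - k.+2 = 0)%N by lia.
    by rewrite !mul0r.
  have k1 : (k.+1 < m.-1)%N by lia.
  by apply: ler_wpM2l => //; exact: (kmin (Ordinal k1) isT).
have h0 : k%:R * D k <= k%:R * (b k - b k.-1).
  case: (posnP k) => [->|k_gt0]; first by rewrite !mul0r.
  apply: ler_wpM2l => //; have k1 : (k.-1 < m.-1)%N by lia.
  by have := kmin (Ordinal k1) isT; rewrite /D /= prednK.
move: Dneg h0 h2 E0 E1 E2 bk0; rewrite /D !natrM /=.
have [t mt] : exists t, m = (t + k.+2)%N by exists (m - k.+2)%N; lia.
have -> : (m - k = t.+2)%N by lia.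
have -> : (m - k.+1 = t.+1)%N by lia.
have -> : (m - k.+2 = t)%N by lia.
rewrite -!natr1.
have : (0 : R) <= k%:R by []. have : (0 : R) <= t%:R by [].
move: (k%:R : R) (t%:R : R) (b k) (b k.+1) (b k.+2) (b k.-1) => K T x y z w.
move=> T0 K0 D0 h0 h2 E0 E1 E2 x0.
have h0' : l * (K + 1) * (K * (y - x)) <= l * (K + 1) * (K * (x - w)).
  by apply: ler_wpM2l => //; apply: mulr_ge0; lra.
(* The second difference of the recurrence at the minimal increment [y - x];
   if that increment were negative, the right side would be too small. *)
have key : T * (z - y) + l * (K + 1) * (K * (x - w)) =
    (l * (K + 3) * (K + 2) + T + 2) * (y - x) + 2 * l * x.
  lra.
have : (l * (K + 3) * (K + 2) + T + 2 - T - l * (K + 1) * K) * (y - x) + 2 * l * x < 0.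
  have : (l * (4 * K + 6) + 2) * (y - x) < 0.
    by rewrite nmulr_llt0 // ltr_wpDl // mulr_ge0 ?ltW //; lra.
  have : l * x <= 0 by rewrite pmulr_rle0.
  by lra.
by lra.
Qed.

(** Multiplying the equation by the stationary weights of the birth-death chain makes its left side
    telescope, so the solution is a quotient of partial sums; the total sum vanishes exactly when
    [c] is the stationary mean. *)
Lemma poisson_solution_pos (R : realFieldType) (m : nat) (l : R) :
  (0 < m)%N -> 0 < l ->
  exists c, exists b : nat -> R,
  [/\ 1 <= c, c <= m.+1%:R,
     forall k, (k < m)%N -> b k <= 0,
     b 0%N = (1 - c) / m%:R &
     forall k, (k <= m)%N ->
     (m - k)%:R * b k - l * (k.+1 * k)%:R * b k.-1 = k.+1%:R - c].
Proof.
move=> m0 l0.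
(* Unnormalised stationary weights, given by detailed balance ([AS] below). *)
pose A := fix A (k : nat) : R :=
  if k is j.+1 then (m - j)%:R * A j / (l * (k.+1 * k)%:R) else 1.
have Apos k : (k <= m)%N -> 0 < A k.
  elim: k => [|k IH] km /=; first exact: ltr01.
  rewrite divr_gt0 // mulr_gt0 ?ltr0n ?muln_gt0 ?subn_gt0 //; apply: IH.
  exact: ltnW.
have AS k : l * (k.+2 * k.+1)%:R * A k.+1 = (m - k)%:R * A k.
  rewrite [A k.+1]/= mulrC divfK //.
  by rewrite mulf_neq0 ?gt_eqF // ?ltr0n.
pose S := \sum_(0 <= j < m.+1) A j.
have Spos : 0 < S.
  rewrite /S big_nat_recl // ltr_wpDr ?ltr01 // big_nat_cond sumr_ge0 // => j.
  by rewrite andbT => /andP[_ jm]; rewrite ltW // Apos.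
pose c := (\sum_(0 <= j < m.+1) j.+1%:R * A j) / S.
pose G k := \sum_(0 <= j < k.+1) (j.+1%:R - c) * A j.
have Gm : G m = 0.
  rewrite /G; under eq_bigr do rewrite mulrBl.
  by rewrite sumrB -mulr_sumr /c divfK ?subrr // gt_eqF.
have c1 : 1 <= c.
  rewrite /c ler_pdivlMr // mul1r /S; apply: ler_sum_nat => j /andP[_ jm].
  by rewrite ler_peMl ?ler1n // ltW // Apos.
have cm : c <= m.+1%:R.
  rewrite /c ler_pdivrMr // /S mulr_sumr; apply: ler_sum_nat => j /andP[_ jm].
  by rewrite ler_wpM2r ?ler_nat // ltW // Apos.
have Gle k : (k <= m)%N -> G k <= 0.
  (* The summands change sign once, from nonpositive to nonnegative: either the partial sum has only
     nonpositive terms, or the remaining tail is nonnegative and the total is 0. *)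
  move=> km; have [kc|kc] := leP k.+1%:R c.
    rewrite /G big_nat_cond sumr_le0 // => j; rewrite andbT => /andP[_ jk].
    rewrite mulr_le0_ge0 ?(ltW (Apos _ _)) ?subr_le0 //; last by lia.
    by apply: le_trans kc; rewrite ler_nat.
  have -> : G k = - \sum_(k.+1 <= j < m.+1) (j.+1%:R - c) * A j.
    apply/eqP; rewrite -subr_eq0 opprK; apply/eqP; rewrite -[RHS]Gm /G.
    by rewrite [RHS](@big_cat_nat _ _ _ k.+1).
  rewrite oppr_le0 big_nat_cond sumr_ge0 // => j; rewrite andbT => /andP[kj jm].
  rewrite mulr_ge0 ?(ltW (Apos _ _)) // subr_ge0 (le_trans (ltW kc)) // ler_nat.
  exact: leqW.
(* At [k = m] the denominator is 0 and the value is 0 by convention; the equation there amounts to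
   [Gm]. *)
exists c, (fun k => G k / ((m - k)%:R * A k)); split => //.
- move=> k km; rewrite mulr_le0_ge0 ?Gle ?(ltnW km) //.
  by rewrite invr_ge0 mulr_ge0 ?(ltW (Apos _ _)) // ltnW.
- by rewrite /G big_nat1 subn0 /= !mulr1.
move=> k km; have Ak := Apos _ km.
have -> : (m - k)%:R * (G k / ((m - k)%:R * A k)) = G k / A k.
  have [->|kltm] := eqVneq k m; first by rewrite Gm !mul0r mulr0.
  have : (m - k)%:R != 0 :> R by rewrite pnatr_eq0; lia.
  by move=> h; field; rewrite h gt_eqF.
case: k km Ak => [|k] km Ak.
  by rewrite muln0 mulr0 mul0r subr0 /G big_nat1 mulfK ?gt_eqF.
have -> : G k.+1 = G k + (k.+2%:R - c) * A k.+1 by rewrite /G big_nat_recr.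
rewrite /= -/(A k.+1) -AS.
have h1 : l * (k.+2 * k.+1)%:R != 0 by rewrite mulf_neq0 ?gt_eqF // ?ltr0n.
have h2 : A k.+1 != 0 by rewrite gt_eqF.
move: h1 h2; move: (l * _) (A k.+1) (G k) (k.+2%:R - c) => u v w z u0 v0.
by field; rewrite u0 v0.
Qed.

(* [b] is the increment of the solution of the Poisson equation for the
   birth-death chain with birth rates [d - x] and death rates [l x (x - 1)];
   [c] is the mean of its stationary law, the law of the free degree in K_{d,d}. *)
Lemma poisson_solution (R : realFieldType) (d : nat) (l : R) :
  (0 < d)%N -> 0 < l ->
  exists c, exists b : nat -> R,
  [/\ 0 < c, {homo b : i j / (i <= j)%N >-> i <= j},
     - c <= d%:R * b 0%N &
     forall x, (0 < x <= d)%N ->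
     (d - x)%:R * b x - l * (x * (x - 1))%:R * b (x - 1)%N = x%:R - c].
Proof.
(* For [d = 1] the only positive free degree is 1, and a constant [b] suffices. *)
case: d => // m _ l0; have [->|m0] := posnP m.
  exists 1, (fun=> -1); split => //; first by rewrite mul1r.
  by case=> [|[|x]] // _; rewrite !subnn !muln0 !mulr0 !mul0r !subr0 subrr.
have [c [b [c1 cm b_le0 b0 Eb]]] := poisson_solution_pos m0 l0.
have bD := poisson_increment_nondecreasing l0 Eb b_le0.
(* The value at 0 gives equality in the third clause, and [c <= d] keeps it below the next value.
   Capping the index at [m - 1] preserves monotonicity; it alters [b] only from [x = d] on, and at
   [x = d] the coefficient [d - x] is 0. *)
exists c, (fun x => if x is k.+1 then b (minn k m.-1) else - c / m.+1%:R); split.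
- by rewrite (lt_le_trans ltr01).
- apply: homo_leq => [//|x y z|[|k] /=]; first exact: le_trans.
    rewrite min0n b0 ler_pdivrMr ?ltr0n // mulrAC ler_pdivlMr ?ltr0n //.
    by move: cm; rewrite -natr1; nra.
  have [km|km] := ltnP k.+1 m.
    by rewrite !(minn_idPl _) ?bD //; lia.
  by rewrite !(minn_idPr _) //; lia.
- by rewrite mulrC divfK // pnatr_eq0.
case=> // k /andP[_ km]; rewrite subSS subn1 /= -(Eb k km); congr (_ - _).
  have [->|kltm] := eqVneq k m; first by rewrite subnn !mul0r.
  by rewrite (minn_idPl _) //; lia.
case: k km => [|k] km; first by rewrite muln0 mulr0 !mul0r.
by rewrite (minn_idPl _) //; lia.
Qed.

Local Open Scope classical_set_scope.

(** * The matching polynomial *)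

(** The monomer-dimer partition function in the activity, with unsigned coefficients. *)
Definition matching_poly (R : nzRingType) (G : sgraph) : {poly R} :=
  \sum_(M : {set {set G}} | matching M) 'X^#|M|.

Lemma horner_matching_poly (R : comNzRingType) (G : sgraph) (l : R) :
  (matching_poly R G).[l] = \sum_(M : {set {set G}} | matching M) l ^+ #|M|.
Proof. by rewrite horner_sum; apply: eq_bigr => M _; rewrite hornerXn. Qed.

Lemma coef_matching_poly (R : nzRingType) (G : sgraph) (k : nat) :
  (matching_poly R G)`_k = (num_matchings k G)%:R.
Proof.
rewrite coef_sum /num_matchings -sum1_card natr_sum [LHS]big_mkcond [RHS]big_mkcond.
apply: eq_bigr => M _; rewrite inE coefXn eq_sym.
by case: (matching M); case: (_ == k).
Qed.

(** Twice the derivative counts oriented matching edges; switching turns these into oriented free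
    edges, counted by free degrees. *)
Lemma horner_deriv_matching_poly (R : comNzRingType) (G : sgraph) (l : R) :
  2%:R * (matching_poly R G)^`().[l] =
  \sum_(M : {set {set G}} | matching M) l ^+ #|M| *
    (\sum_(u in uncovered M) (free_degree M u)%:R).
Proof.
rewrite raddf_sum horner_sum mulr_sumr.
transitivity (\sum_(M : {set {set G}} | matching M)
    \sum_v \sum_(w | [set v; w]%SET \in M) l ^+ #|M|.-1).
  apply: eq_bigr => M mM; rewrite /= derivXn hornerMn hornerXn.
  rewrite mulr_natl -mulrnA mulnC -sum_pairs_matching // -mulr_natl natr_sum mulr_suml.
  apply: eq_bigr => v _; rewrite natr_sum mulr_suml.
  by apply: eq_bigr => w _; rewrite mul1r.
rewrite (edge_switch (fun M _ _ => l ^+ #|M|.-1)); apply: eq_bigr => M mM.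
rewrite mulr_sumr; apply: eq_bigr => v vM.
rewrite mulr_natr -sum_free_degree; apply: eq_bigr => w _.
by rewrite card_add_edge.
Qed.

Lemma sum_card_uncovered (R : comNzRingType) (G : sgraph) (l : R) :
  \sum_(M : {set {set G}} | matching M) l ^+ #|M| * #|uncovered M|%:R =
  #|G|%:R * (matching_poly R G).[l] - 2%:R * l * (matching_poly R G)^`().[l].
Proof.
rewrite horner_matching_poly raddf_sum horner_sum !mulr_sumr -sumrB.
apply: eq_bigr => M mM; rewrite /= derivXn hornerMn hornerXn -(card_uncovered mM).
rewrite natrD natrM; case: #|M| => [|k]; first by rewrite expr0 mulr0n; ring.
by rewrite /= exprS -(mulr_natl (l ^+ k)); ring.
Qed.

(** The constant [c] depends on [d] and [l] only. Replacing [x - c] by the left side of the Poisson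
    equation makes its weighted sum nonpositive, by switching and rearrangement; the derivative and
    the uncovered count then rewrite that sum as the difference of the two sides. *)
Lemma monomer_dimer_occupancy (R : realFieldType) (d : nat) (l : R) :
  (0 < d)%N -> 0 < l -> exists2 c : R, 0 < c &
  forall G : sgraph, regular d G ->
  2%:R * (matching_poly R G)^`().[l] * (1 + c * l) <= c * #|G|%:R * (matching_poly R G).[l]
  /\ (balanced G ->
  2%:R * (matching_poly R G)^`().[l] * (1 + c * l) = c * #|G|%:R * (matching_poly R G).[l]).
Proof.
move=> d0 l0; have [c [b [c0 hb b0 E]]] := poisson_solution d0 l0.
exists c => // G rG.
pose S := \sum_(M : {set {set G}} | matching M) l ^+ #|M| *
    (\sum_(u in uncovered M) ((free_degree M u)%:R - c)).
have ES : S = 2%:R * (matching_poly R G)^`().[l] * (1 + c * l)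
              - c * #|G|%:R * (matching_poly R G).[l].
  rewrite mulrDr mulr1 horner_deriv_matching_poly.
  have -> : S = \sum_(M : {set {set G}} | matching M) l ^+ #|M| *
    (\sum_(u in uncovered M) (free_degree M u)%:R) -
    c * \sum_(M : {set {set G}} | matching M) l ^+ #|M| * #|uncovered M|%:R.
    rewrite mulr_sumr -sumrB; apply: eq_bigr => M _.
    rewrite sumrB sumr_const mulrBr; congr (_ - _).
    by rewrite mulrCA mulr_natr.
  rewrite sum_card_uncovered -horner_deriv_matching_poly.
  by move: #|G|%:R (matching_poly R G).[l] (matching_poly R G)^`().[l] => n p p'; ring.
pose P (M : {set {set G}}) := \sum_(u in uncovered M)
  ((d - free_degree M u)%:R * b (free_degree M u) -
   l * (free_degree M u * (free_degree M u - 1))%:R * b (free_degree M u - 1)%N).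
have EP : \sum_(M : {set {set G}} | matching M) l ^+ #|M| * P M =
    l * \sum_(M : {set {set G}} | matching M) l ^+ #|M| *
    (\sum_(v in uncovered M) \sum_(w in uncovered M | adj v w)
      \sum_(u in uncovered M | (u != w) && adj u v)
        b (free_degree M u - 1 - adj u w)%N) -
   l * \sum_(M : {set {set G}} | matching M) l ^+ #|M| *
   (\sum_(u in uncovered M) (free_degree M u * (free_degree M u - 1))%:R
     * b (free_degree M u - 1)%N).
  rewrite -(edge_switch_free_degree _ _ rG) mulr_sumr -sumrB.
  apply: eq_bigr => M _; rewrite /P sumrB mulrBr; congr (_ - _).
  rewrite [RHS]mulrCA; congr (_ * _); rewrite mulr_sumr.
  by apply: eq_bigr => u _; rewrite mulrA.
(* At [x = 0] only the inequality [- c <= d * b 0] is available; in a balanced graph no uncovered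
   vertex has free degree 0. *)
have le_b x : (x <= d)%N -> x%:R - c <=
    (d - x)%:R * b x - l * (x * (x - 1))%:R * b (x - 1)%N.
  case: x => [|x] xd; last by rewrite E.
  by rewrite !subn0 mul0n mulr0 mul0r sub0r subr0.
rewrite -subr_le0 -ES; split.
  apply: (@le_trans _ _ (\sum_(M : {set {set G}} | matching M) l ^+ #|M| * P M)).
    apply: ler_sum => M _; rewrite ler_wpM2l ?exprn_ge0 ?(ltW l0) //.
    by apply: ler_sum => u _; apply: le_b; apply: free_degree_le.
  rewrite EP subr_le0 ler_wpM2l ?(ltW l0) //; apply: ler_sum => M _.
  by rewrite ler_wpM2l ?exprn_ge0 ?(ltW l0) //; apply: sum_free_paths_le.
move=> bal; apply/eqP; rewrite -subr_eq0 -ES; apply/eqP.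
transitivity (\sum_(M : {set {set G}} | matching M) l ^+ #|M| * P M).
  apply: eq_bigr => M mM; congr (_ * _); apply: eq_bigr => u uM.
  have [_ _ h] := bal; rewrite E // h //=; exact: free_degree_le.
rewrite EP; apply/eqP; rewrite subr_eq0; apply/eqP; congr (_ * _).
by apply: eq_bigr => M mM; congr (_ * _); apply: sum_free_paths_balanced.
Qed.


(** * Recurrences for the numbers of matchings of each size *)

(** The switch restricted to one size: each matching of size [k + 1] arises from its [2 (k + 1)]
    oriented edges. *)
Lemma sum_free_degrees_of_size (G : sgraph) (k : nat) :
  (\sum_(M : {set {set G}} | matching M && (#|M| == k))
     \sum_(u in uncovered M) free_degree M u = 2 * k.+1 * num_matchings k.+1 G)%N.
Proof.
have -> : (2 * k.+1 * num_matchings k.+1 G = \sum_(M : {set {set G}} | matching M)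
    \sum_v \sum_(w | [set v; w]%SET \in M) (#|M| == k.+1))%N.
  rewrite /num_matchings -sum1_card big_distrr [LHS]big_mkcond [RHS]big_mkcond.
  apply: eq_bigr => M _; rewrite inE; case: ifP => [/andP[mM /eqP Mk]|].
    by rewrite mM /= muln1 -Mk -sum_pairs_matching // eqxx.
  by case: (matching M) => //= ->; rewrite big1 // => v _; rewrite big1.
rewrite (edge_switch (fun M _ _ => (#|M| == k.+1) : nat)).
rewrite big_mkcondr; apply: eq_bigr => M mM.
case: ifP => Mk; last first.
  rewrite big1 // => v vM; rewrite big1 // => w _.
  by rewrite card_add_edge // eqSS Mk.
apply: eq_bigr => v vM; rewrite (eq_bigr (fun=> 1%N)) ?sum1_card.
  by apply: eq_card => w; rewrite finset.in_set unfold_in.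
by move=> w _; rewrite card_add_edge // eqSS Mk.
Qed.

Lemma num_matchingsS_le (d : nat) (G : sgraph) (k : nat) :
  regular d G ->
  (2 * k.+1 * num_matchings k.+1 G <= #|G| * d * num_matchings k G)%N.
Proof.
move=> rG; rewrite -sum_free_degrees_of_size.
rewrite /num_matchings -sum1_card big_distrr /=.
rewrite [leqRHS](eq_bigl (fun M => matching M && (#|M| == k))); last first.
  by move=> M; rewrite inE.
apply: leq_sum => M _; rewrite muln1.
apply: (@leq_trans (\sum_(u in uncovered M) d)).
  by apply: leq_sum => u _; apply: free_degree_le.
by rewrite sum_nat_const leq_mul2r max_card orbT.
Qed.

(** Each of the [#|G| - 2 k] uncovered vertices has a free neighbour. *)
Lemma num_matchings_le_numS (G : sgraph) (k : nat) :
  balanced G ->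
  ((#|G| - 2 * k) * num_matchings k G <= 2 * k.+1 * num_matchings k.+1 G)%N.
Proof.
case=> _ _ pos; rewrite -sum_free_degrees_of_size.
rewrite /num_matchings -sum1_card big_distrr /=.
rewrite [leqLHS](eq_bigl (fun M => matching M && (#|M| == k))); last first.
  by move=> M; rewrite inE.
apply: leq_sum => M /andP[mM /eqP <-]; rewrite muln1.
rewrite -(card_uncovered mM) addnK -sum1_card.
by apply: leq_sum => u uM; apply: pos.
Qed.

Lemma matching0 (G : sgraph) : matching (finset.set0 : {set {set G}}).
Proof.
apply/andP; split; first exact: finset.sub0set.
by apply/finset.trivIsetP => A B; rewrite inE.
Qed.

Lemma num_matchings0 (G : sgraph) : num_matchings 0 G = 1%N.
Proof.
rewrite /num_matchings (_ : [set M | _]%SET = [set finset.set0]%SET) ?cards1 //.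
apply/setP => M; rewrite !inE cards_eq0.
by case: eqVneq => [->|]; rewrite ?andbF ?matching0.
Qed.

Lemma num_matchings_gt_half (G : sgraph) (k : nat) :
  (#|G| < 2 * k)%N -> num_matchings k G = 0%N.
Proof.
move=> Gk; apply: eq_card0 => M; rewrite inE; apply/negP => /andP[mM /eqP Mk].
by move: Gk; rewrite -(card_uncovered mM) Mk; lia.
Qed.

Lemma num_matchings_balanced_gt0 (G : sgraph) (k : nat) :
  balanced G -> (2 * k <= #|G|)%N -> (0 < num_matchings k G)%N.
Proof.
move=> bG; elim: k => [|k IH] kG; first by rewrite num_matchings0.
have := num_matchings_le_numS k bG.
have : (0 < #|G| - 2 * k)%N by lia.
have : (0 < num_matchings k G)%N by apply: IH; lia.
by nia.
Qed.

Lemma size_matching_poly (R : nzRingType) (G : sgraph) (m : nat) :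
  #|G| = (2 * m)%N -> (size (matching_poly R G) <= m.+1)%N.
Proof.
move=> Gm; apply/leq_sizeP => j jm; rewrite coef_matching_poly.
by rewrite num_matchings_gt_half // Gm; lia.
Qed.

Lemma matching_poly_ge1 (R : realFieldType) (G : sgraph) (l : R) :
  0 <= l -> 1 <= (matching_poly R G).[l].
Proof.
move=> l0; rewrite horner_matching_poly (bigD1 finset.set0) ?matching0 //=.
by rewrite cards0 expr0 lerDl sumr_ge0 // => M _; rewrite exprn_ge0.
Qed.

Lemma num_matchings_term_le (R : realFieldType) (G : sgraph) (k : nat) (l : R) :
  0 <= l -> (num_matchings k G)%:R * l ^+ k <= (matching_poly R G).[l].
Proof.
move=> l0; rewrite horner_matching_poly (bigID (fun M : {set {set G}} => #|M| == k)) /=.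
rewrite ler_wpDr //; first by apply: sumr_ge0 => M _; rewrite exprn_ge0.
rewrite /num_matchings -sum1_card natr_sum mulr_suml.
rewrite [leLHS](eq_bigl (fun M : {set {set G}} => matching M && (#|M| == k))); last first.
  by move=> M; rewrite inE.
by apply: ler_sum => M /andP[_ /eqP ->]; rewrite mul1r.
Qed.

(** * Comparison with balanced graphs *)

Lemma horner0_matching_poly (R : comNzRingType) (G : sgraph) :
  (matching_poly R G).[0] = 1.
Proof. by rewrite horner_coef0 coef_matching_poly num_matchings0. Qed.

(** The hypothesis makes the derivative of [f / g] nonpositive, and the quotient is 1 at 0. *)
Lemma horner_le_of_log_deriv (R : realType) (f g : {poly R}) (l : R) :
  f.[0] = 1 -> g.[0] = 1 -> 0 <= l -> (forall x : R, 0 <= x -> 0 < g.[x]) ->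
  (forall x : R, 0 < x -> f^`().[x] * g.[x] <= f.[x] * g^`().[x]) ->
  f.[l] <= g.[l].
Proof.
move=> f0 g0 l0 gpos H.
pose h (x : R) := f.[x] * (g.[x])^-1.
have dh (x : R) : 0 <= x -> is_derive x (1 : R) h
    (f.[x] * (- (g.[x]) ^- 2 * g^`().[x]) + (g.[x])^-1 * f^`().[x]).
  move=> x0; have gx := gpos _ x0.
  have dg : is_derive x (1 : R) (fun y => (g.[y])^-1) (- (g.[x]) ^- 2 * g^`().[x]).
    apply: DeriveDef; first by apply: derivableV; rewrite ?gt_eqF.
    by rewrite deriveV ?gt_eqF // derive_val.
  exact: is_deriveM.
have hh : h l <= h 0.
  apply: (@ler0_derive1_le_cc R h 0 l); rewrite ?in_itv /= ?lexx ?l0 //.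
  - move=> x; rewrite in_itv /= => /andP[x0 _]; have := dh x (ltW x0).
    by move=> ?; apply: ex_derive.
  - move=> x; rewrite in_itv /= => /andP[x0 _]; have := dh x (ltW x0).
    move=> ?; rewrite derive1E derive_val.
    have gx := gpos _ (ltW x0); have := H _ x0.
    rewrite -subr_le0 => Hx.
    have -> : f.[x] * (- g.[x] ^- 2 * g^`().[x]) + g.[x]^-1 * f^`().[x] =
      (f^`().[x] * g.[x] - f.[x] * g^`().[x]) * g.[x] ^- 2.
      by field; rewrite gt_eqF.
    by rewrite mulr_le0_ge0 // invr_ge0 exprn_ge0 // ltW.
  apply: derivable_within_continuous => x; rewrite in_itv /= => /andP[x0 _].
  by have := dh x x0 => ?; apply: ex_derive.
by move: hh; rewrite /h f0 g0 divr1 ler_pdivrMr ?gpos // mul1r.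
Qed.

(** Both graphs share the constant [c] of [monomer_dimer_occupancy]; it is eliminated between the
    inequality for [G] and the equality for [B]. *)
Lemma matching_poly_deriv_balanced_le (R : realFieldType) (d : nat) (G B : sgraph) (x : R) :
  (0 < d)%N -> regular d G -> regular d B -> balanced B -> 0 < x ->
  #|B|%:R * (matching_poly R G)^`().[x] * (matching_poly R B).[x] <=
  #|G|%:R * (matching_poly R G).[x] * (matching_poly R B)^`().[x].
Proof.
move=> d0 rG rB bB x0; have [c c0 H] := monomer_dimer_occupancy d0 x0.
have [hG _] := H _ rG; have [_ /(_ bB) hB] := H _ rB.
have pB : 0 <= (matching_poly R B).[x].
  by rewrite (le_trans ler01) // matching_poly_ge1 // ltW.
have u0 : 0 < 2%:R * (1 + c * x) by rewrite mulr_gt0 // ltr_wpDl // mulr_gt0.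
rewrite -(ler_pM2l u0).
move: hG hB pB; move: (#|B|%:R : R) (ler0n R #|B|) (#|G|%:R : R).
move: (matching_poly R B).[x] (matching_poly R B)^`().[x].
move: (matching_poly R G).[x] (matching_poly R G)^`().[x].
move=> p p' q q' m m0 n hG hB q0.
have -> : 2%:R * (1 + c * x) * (n * p * q') = (m * q) * (c * n * p).
  have -> : 2%:R * (1 + c * x) * (n * p * q') = n * p * (2%:R * q' * (1 + c * x)) by ring.
  by rewrite hB; ring.
have -> : 2%:R * (1 + c * x) * (m * p' * q) = (m * q) * (2%:R * p' * (1 + c * x)) by ring.
by rewrite ler_wpM2l // mulr_ge0.
Qed.

Lemma matching_poly_balanced_le (R : realType) (d : nat) (G B : sgraph) (l : R) :
  (0 < d)%N -> (0 < #|G|)%N -> (0 < #|B|)%N ->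
  regular d G -> regular d B -> balanced B -> 0 <= l ->
  (matching_poly R G).[l] ^+ #|B| <= (matching_poly R B).[l] ^+ #|G|.
Proof.
move=> d0 G0 B0 rG rB bB l0; rewrite -!horner_exp.
have pos (H : sgraph) (x : R) : 0 <= x -> 0 < (matching_poly R H).[x].
  by move=> x0; rewrite (lt_le_trans ltr01) // matching_poly_ge1.
apply: horner_le_of_log_deriv => //.
- by rewrite horner_exp horner0_matching_poly expr1n.
- by rewrite horner_exp horner0_matching_poly expr1n.
- by move=> x x0; rewrite horner_exp exprn_gt0 // pos.
move=> x x0; rewrite !deriv_exp !hornerMn !hornerM !horner_exp.
rewrite -[_ *+ #|B|]mulr_natl -[_ *+ #|G|]mulr_natl.
have := matching_poly_deriv_balanced_le d0 rG rB bB x0.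
have := pos G x (ltW x0); have := pos B x (ltW x0).
move: (matching_poly R B).[x] (matching_poly R B)^`().[x].
move: (matching_poly R G).[x] (matching_poly R G)^`().[x].
case: #|G| G0 => // n _; case: #|B| B0 => // m _ p p' q q' q0 p0 H.
rewrite /= !exprS.
have -> : m.+1%:R * (p' * p ^+ m) * (q * q ^+ n) =
  (p ^+ m * q ^+ n) * (m.+1%:R * p' * q) by ring.
have -> : p * p ^+ m * (n.+1%:R * (q' * q ^+ n)) =
  (p ^+ m * q ^+ n) * (n.+1%:R * p * q') by ring.
by rewrite ler_wpM2l // mulr_ge0 // exprn_ge0 // ltW.
Qed.

Lemma poly_eq_natr (R : numDomainType) (p q : {poly R}) :
  (forall k : nat, p.[k%:R] = q.[k%:R]) -> p = q.
Proof.
move=> pq; apply/eqP; rewrite -subr_eq0; apply: contraT => nz.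
pose rs : seq R := [seq k%:R | k <- iota 0 (size (p - q))].
have allr : all (root (p - q)) rs.
  by apply/allP => _ /mapP[k _ ->]; rewrite rootE !hornerE pq subrr.
have urs : uniq rs by rewrite map_inj_uniq ?iota_uniq //; apply: mulrIn; rewrite oner_eq0.
by have := max_poly_roots nz allr urs; rewrite size_map size_iota ltnn.
Qed.

(** Comparing two balanced graphs in both directions forces equality. This yields multiplicativity
    over disjoint copies without splitting matchings into components. *)
Lemma matching_poly_balanced_exp (R : realType) (d q : nat) (B H : sgraph) :
  (0 < d)%N -> (0 < q)%N -> (0 < #|B|)%N -> #|H| = (#|B| * q)%N ->
  regular d B -> regular d H -> balanced B -> balanced H ->
  matching_poly R H = matching_poly R B ^+ q.
Proof.
move=> d0 q0 B0 HB rB rH bB bH; apply: poly_eq_natr => k; rewrite horner_exp.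
have H0 : (0 < #|H|)%N by rewrite HB muln_gt0 B0.
have k0 : 0 <= k%:R :> R by [].
have h1 := matching_poly_balanced_le d0 H0 B0 rH rB bB k0.
have h2 := matching_poly_balanced_le d0 B0 H0 rB rH bH k0.
have ge0 (K : sgraph) : 0 <= (matching_poly R K).[k%:R].
  by rewrite (le_trans ler01) // matching_poly_ge1.
apply/eqP; rewrite -(@eqrXn2 R #|B|) ?exprn_ge0 //.
by rewrite -exprM mulnC -HB eq_le h1 h2.
Qed.

(** * Unions of complete bipartite graphs *)

Lemma copies_bipartite_regular (q d : nat) :
  regular d (copies q (complete_bipartite d)).
Proof.
move=> [i [s a]]; rewrite -[RHS]card_ord -cardsT.
have inj : injective (fun b : 'I_d => ((i, (~~ s, b)) : copies q (complete_bipartite d))).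
  by move=> b b' [].
rewrite -(card_imset _ inj); apply: eq_card => -[j [t b]]; rewrite inE.
rewrite /adj /= /copies_adj /= /complete_bipartite_adj /=.
apply/andP/imsetP => [[/eqP -> st]|[b' _ [-> -> _]]].
  by exists b => //; congr (_, (_, _)); clear inj; case: s t st => -[].
by rewrite eqxx; case: (s).
Qed.

Lemma card_copies_bipartite (q d : nat) :
  #|copies q (complete_bipartite d)| = (2 * d * q)%N.
Proof. by rewrite card_prod card_prod card_bool !card_ord mulnC. Qed.

Definition copy_side (q d : nat) (i : 'I_q) (s : bool) :
  {set copies q (complete_bipartite d)} := [set v | (v.1 == i) && (v.2.1 == s)]%SET.

Lemma copies_bipartite_adjE (q d : nat) (u v : copies q (complete_bipartite d)) :
  adj u v = (v \in copy_side d u.1 (~~ u.2.1)).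
Proof.
rewrite inE /adj /= /copies_adj /= /complete_bipartite_adj /= eq_sym.
by case: (u.2.1); case: (v.2.1).
Qed.

Lemma copies_bipartite_side_swap (q d : nat) (i : 'I_q) (s : bool)
    (v w : copies q (complete_bipartite d)) :
  adj v w -> (v \in copy_side d i s) = (w \in copy_side d i (~~ s)).
Proof.
rewrite copies_bipartite_adjE !inE => /andP[/eqP -> /eqP ->].
by case: (v.2.1); case: s.
Qed.

Lemma card_copy_side (q d : nat) (i : 'I_q) (s : bool) : #|copy_side d i s| = d.
Proof.
rewrite -[RHS]card_ord -cardsT.
have inj : injective (fun b : 'I_d => ((i, (s, b)) : copies q (complete_bipartite d))).
  by move=> b b' [].
rewrite -(card_imset _ inj); apply: eq_card => -[j [t b]]; rewrite inE /=.
apply/andP/imsetP => [[/eqP -> /eqP ->]|[b' _ [-> -> _]]]; first by exists b.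
by rewrite !eqxx.
Qed.

(** Every matching edge in a copy covers one vertex on each side, and both sides have [d]
    vertices. *)
Lemma card_uncovered_side (q d : nat) (M : {set {set copies q (complete_bipartite d)}})
    (i : 'I_q) (s : bool) :
  matching M ->
  #|uncovered M :&: copy_side d i s|%SET = #|uncovered M :&: copy_side d i (~~ s)|%SET.
Proof.
move=> mM.
have side t : (#|uncovered M :&: copy_side d i t|%SET +
    \sum_(v in copy_side d i t) \sum_(w | [set v; w]%SET \in M) 1 = d)%N.
  rewrite -[RHS](card_copy_side d i t) -(cardsID (uncovered M) (copy_side d i t)) finset.setIC.
  congr (_ + _)%N; rewrite -sum1_card [LHS]big_mkcond [RHS]big_mkcond /=.
  apply: eq_bigr => v _.
  rewrite (@sum_mates (copies q (complete_bipartite d)) nat M v 1%N mM) finset.in_setD.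
  by case: (v \in uncovered M); case: (v \in copy_side d i t).
have E : (\sum_(v in copy_side d i s) \sum_(w | [set v; w]%SET \in M) 1 =
          \sum_(v in copy_side d i (~~ s)) \sum_(w | [set v; w]%SET \in M) 1)%N.
  rewrite (exchange_big_dep (mem (copy_side d i (~~ s)))) /=; last first.
    by move=> v w vs /(matching_adj mM)/copies_bipartite_side_swap <-.
  apply: eq_bigr => w ws; apply: eq_bigl => v; rewrite finset.setUC.
  case: (boolP (_ \in M)) => [vwM|_]; last by rewrite andbF.
  have wv := matching_adj mM vwM; rewrite adj_sym in wv.
  by rewrite (copies_bipartite_side_swap i s wv) ws.
by have := side s; have := side (~~ s); rewrite E; lia.
Qed.

Lemma free_degree_copies_bipartite (q d : nat)
    (M : {set {set copies q (complete_bipartite d)}}) u :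
  free_degree M u = #|uncovered M :&: copy_side d u.1 (~~ u.2.1)|%SET.
Proof.
by apply: eq_card => v; rewrite finset.in_setI finset.in_set copies_bipartite_adjE.
Qed.

(** The free degree of [u] is the number of uncovered vertices opposite to it, which equals the
    number on its own side; when [u] is uncovered, that side contains it. *)
Lemma copies_bipartite_balanced (q d : nat) : balanced (copies q (complete_bipartite d)).
Proof.
split=> [u v w|M u v mM uM vM|M u mM uM].
- rewrite !copies_bipartite_adjE !inE => /andP[_ /eqP ->] /andP[_ /eqP ->].
  by rewrite negbK; case: (u.2.1); rewrite andbF.
- rewrite copies_bipartite_adjE !inE => /andP[/eqP v1 /eqP v2].
  by rewrite !free_degree_copies_bipartite v1 v2 negbK -card_uncovered_side.
rewrite free_degree_copies_bipartite -card_uncovered_side // card_gt0.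
by apply/finset.set0Pn; exists u; rewrite finset.in_setI uM finset.in_set !eqxx.
Qed.

(** * Coefficients of powers *)

(** For the weights given by the coefficient of degree [k] times [l ^+ k], the Euler operator
    applied once or twice produces the unnormalised first or second moment. *)
Lemma coef_euler (R : comNzRingType) (p : {poly R}) (k : nat) :
  ('X * p^`())`_k = p`_k *+ k.
Proof. by rewrite coefXM; case: k => [|k] //=; rewrite coef_deriv. Qed.

Lemma size_euler (R : comNzRingType) (p : {poly R}) (n : nat) :
  (size p <= n)%N -> (size ('X * p^`())%R <= n)%N.
Proof.
move=> /leq_sizeP pn; apply/leq_sizeP => j jn.
by rewrite coef_euler pn // mul0rn.
Qed.

Lemma horner_euler (R : comNzRingType) (p : {poly R}) (n : nat) (l : R) :
  (size p <= n)%N -> ('X * p^`()).[l] = \sum_(k < n) k%:R * (p`_k * l ^+ k).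
Proof.
move=> pn; rewrite (horner_coef_wide l (size_euler pn)).
by apply: eq_bigr => k _; rewrite coef_euler mulr_natl mulrnAl.
Qed.

Lemma horner_euler2 (R : comNzRingType) (p : {poly R}) (n : nat) (l : R) :
  (size p <= n)%N ->
  ('X * ('X * p^`())^`()).[l] = \sum_(k < n) k%:R ^+ 2 * (p`_k * l ^+ k).
Proof.
move=> pn; rewrite (horner_euler l (size_euler pn)).
apply: eq_bigr => k _; rewrite coef_euler -[p`_k *+ k]mulr_natl.
by ring.
Qed.

Lemma eulerM (R : comNzRingType) (p q : {poly R}) :
  'X * (p * q)^`() = 'X * p^`() * q + p * ('X * q^`()).
Proof. by rewrite derivM; ring. Qed.

(** Mean and second moment of a sum of [q] independent copies of a law with mean [mu] and second
    moment at most [D], by induction with the Leibniz rule. *)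
Lemma euler_exp_moments (R : realFieldType) (p : {poly R}) (l mu D : R) (q : nat) :
  0 <= p.[l] -> ('X * p^`()).[l] = mu * p.[l] ->
  ('X * ('X * p^`())^`()).[l] <= D * p.[l] ->
  ('X * (p ^+ q)^`()).[l] = q%:R * mu * p.[l] ^+ q /\
  ('X * ('X * (p ^+ q)^`())^`()).[l] <=
    (q%:R * D + (q%:R * mu) ^+ 2 - q%:R * mu ^+ 2) * p.[l] ^+ q.
Proof.
move=> p0 E1 E2; elim: q => [|q [IH1 IH2]].
  by rewrite !expr0 derivC mulr0 derivC mulr0 !hornerE; split => //; lra.
have -> : 'X * ('X * (p ^+ q.+1)^`())^`() = ('X * ('X * p^`())^`()) * p ^+ q +
    ('X * p^`()) * ('X * (p ^+ q)^`()) *+ 2 + p * ('X * ('X * (p ^+ q)^`())^`()).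
  rewrite exprS (eulerM p (p ^+ q)) derivD mulrDr.
  by rewrite (eulerM ('X * p^`())) (eulerM p ('X * _)); ring.
rewrite exprS (eulerM p (p ^+ q)) !(hornerD, hornerMn, hornerM (_ * _) (_ ^+ _), hornerM p).
rewrite (hornerM ('X * p^`()) ('X * (p ^+ q)^`())) IH1 E1 horner_exp exprS -natr1.
have := exprn_ge0 q p0; move: IH2 E2 p0.
move: (('X * ('X * p^`())^`()).[l]) (('X * ('X * (p ^+ q)^`())^`()).[l]) => a b.
move: p.[l] (p.[l] ^+ q) => x y hb ha x0 y0.
split; first by ring.
have h1 : a * y <= D * x * y by rewrite ler_wpM2r.
have h2 := ler_wpM2l x0 hb.
nra.
Qed.

(* Chebyshev: the law with weights proportional to (p^q)_k l^k has mean q mu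
   and variance at most q d^2, hence mass at least 3/4 near q mu. *)
Lemma exists_large_term (R : realFieldType) (p : {poly R}) (l mu : R) (d q : nat) :
  (0 < d)%N -> (0 < q)%N -> (size p <= d.+1)%N -> (forall k, 0 <= p`_k) ->
  0 < l -> 0 < p.[l] ->
  ('X * p^`()).[l] = mu * p.[l] ->
  (forall k, 0 <= (p ^+ q)`_k) ->
  exists k, [/\ (k <= d * q)%N, (k%:R - q%:R * mu) ^+ 2 <= 4 * d%:R ^+ 2 * q%:R &
    p.[l] ^+ q <= 2 * (d * q).+1%:R * ((p ^+ q)`_k * l ^+ k)].
Proof.
move=> d0 q0 sp pk l0 pl E1 pqk.
have sq : (size (p ^+ q) <= (d * q).+1)%N.
  have := size_exp_leq p q; have : ((size p).-1 * q <= d * q)%N by rewrite leq_mul2r; lia.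
  by lia.
have E2 : ('X * ('X * p^`())^`()).[l] <= d%:R ^+ 2 * p.[l].
  rewrite (horner_euler2 l sp) (horner_coef_wide l sp) mulr_sumr; apply: ler_sum => k _.
  rewrite ler_wpM2r ?mulr_ge0 ?exprn_ge0 ?(ltW l0) //.
  by rewrite lerXn2r ?nnegrE ?ler_nat // -ltnS.
have [M1 M2] := euler_exp_moments q (ltW pl) E1 E2.
pose t k := (p ^+ q)`_k * l ^+ k.
have t0 k : 0 <= t k by rewrite mulr_ge0 // exprn_ge0 // ltW.
have F0 : p.[l] ^+ q = \sum_(k < (d * q).+1) t k.
  by rewrite -horner_exp (horner_coef_wide l sq).
have V : \sum_(k < (d * q).+1) (k%:R - q%:R * mu) ^+ 2 * t k <= q%:R * d%:R ^+ 2 * p.[l] ^+ q.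
  have -> : \sum_(k < (d * q).+1) (k%:R - q%:R * mu) ^+ 2 * t k =
     ('X * ('X * (p ^+ q)^`())^`()).[l] - 2 * (q%:R * mu) * ('X * (p ^+ q)^`()).[l]
       + (q%:R * mu) ^+ 2 * p.[l] ^+ q.
    rewrite (horner_euler2 l sq) (horner_euler l sq) F0 !mulr_sumr -sumrB -big_split /=.
    by apply: eq_bigr => k _; rewrite -/(t k); ring.
  rewrite M1; move: M2; have := exprn_ge0 q (ltW pl).
  have : 0 <= q%:R * mu ^+ 2 by rewrite mulr_ge0 // sqr_ge0.
  move: (p.[l] ^+ q) (q%:R : R) ('X * _).[l] => y Q z h1 h2 h3.
  have := mulr_ge0 h1 h2; lra.
have Fpos : 0 < p.[l] ^+ q by rewrite exprn_gt0.
apply: contrapT => none.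
(* If no term were large, the first summand would bound the terms inside the window and the second
   those outside; the total would be at most 1/2 + 1/4 of itself. *)
have bad (k : 'I_(d * q).+1) : t k <= p.[l] ^+ q / (2 * (d * q).+1%:R)
     + (k%:R - q%:R * mu) ^+ 2 * t k / (4 * d%:R ^+ 2 * q%:R).
  have den : 0 < 4 * d%:R ^+ 2 * q%:R :> R by rewrite !mulr_gt0 ?exprn_gt0 ?ltr0n.
  have [in_w|out_w] := leP ((k%:R - q%:R * mu) ^+ 2) (4 * d%:R ^+ 2 * q%:R).
    apply: ler_wpDr.
      by apply: divr_ge0; [apply: mulr_ge0; [exact: sqr_ge0|exact: t0]|exact: ltW].
    rewrite ler_pdivlMr ?mulr_gt0 ?ltr0n // mulrC leNgt; apply/negP => lt.
    by apply: none; exists k; rewrite -ltnS ltn_ord; split => //; apply: ltW.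
  rewrite ler_wpDl ?divr_ge0 ?(ltW Fpos) ?mulr_ge0 //.
  by rewrite ler_pdivlMr // mulrC ler_wpM2r // ltW.
have : \sum_(k < (d * q).+1) t k <= p.[l] ^+ q / 2 + p.[l] ^+ q / 4.
  apply: le_trans (ler_sum _ (fun k _ => bad k)) _; rewrite big_split /=.
  apply: lerD.
    by rewrite sumr_const card_ord -[leLHS]mulr_natr invfM mulrA mulfVK //.
  rewrite -mulr_suml ler_pdivrMr ?mulr_gt0 ?exprn_gt0 ?ltr0n //.
  by apply: le_trans V _; rewrite le_eqVlt; apply/orP; left; apply/eqP; field.
by rewrite -F0; move: Fpos; lra.
Qed.

(** The mean of the weights is 0 at [l = 0] and tends to the degree [d] for large [l], so the
    intermediate value theorem applies. *)
Lemma exists_mean_activity (R : rcfType) (p : {poly R}) (d : nat) (mu : R) :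
  size p = d.+1 -> (forall k, 0 <= p`_k) -> 0 < p`_0 -> 0 < mu -> mu < d%:R ->
  exists2 l, 0 < l & ('X * p^`()).[l] = mu * p.[l].
Proof.
move=> sp pk p0 mu0 mud.
pose Q := 'X * p^`() - mu *: p.
have Q0 : Q.[0] < 0.
  by rewrite hornerD hornerN hornerZ hornerM hornerX mul0r sub0r oppr_lt0 horner_coef0 mulr_gt0.
have QE (l : R) : Q.[l] = \sum_(k < d.+1) (k%:R - mu) * (p`_k * l ^+ k).
  have sp' : (size p <= d.+1)%N by rewrite sp.
  rewrite hornerD hornerN hornerZ (horner_euler l sp') (horner_coef_wide l sp').
  by rewrite mulr_sumr -sumrB; apply: eq_bigr => k _; rewrite mulrBl.
have pd : 0 < p`_d.
  rewrite lt_def pk andbT; have : lead_coef p != 0 by rewrite lead_coef_eq0 -size_poly_eq0 sp.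
  by rewrite lead_coefE sp.
have d0 : (0 < d)%N by have := lt_trans mu0 mud; rewrite ltr0n.
pose T := \sum_(k < d) p`_k.
have T0 : 0 <= T by apply: sumr_ge0 => k _; apply: pk.
pose c := (d%:R - mu) * p`_d.
have c0 : 0 < c by rewrite mulr_gt0 // subr_gt0.
(* Chosen so that [c L - mu T = c]: the top term outweighs all negative contributions. *)
pose L := 1 + mu * T / c.
have L1 : 1 <= L.
  by rewrite lerDl; apply: divr_ge0; [apply: mulr_ge0; [exact: ltW|]|exact: ltW].
have QL : 0 <= Q.[L].
  rewrite QE big_ord_recr /= mulrA -/c.
  apply: (@le_trans _ _ (\sum_(k < d) (- mu) * (p`_k * L ^+ d.-1) + c * L ^+ d)); last first.
    rewrite lerD2r; apply: ler_sum => k _.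
    have h0 : 0 <= p`_k * L ^+ k by rewrite mulr_ge0 // exprn_ge0 // (le_trans ler01).
    have h1 : p`_k * L ^+ k <= p`_k * L ^+ d.-1.
      by rewrite ler_wpM2l // ler_weXn2l //; have := ltn_ord k; lia.
    have h2 : 0 <= k%:R * (p`_k * L ^+ k) by rewrite mulr_ge0.
    by nra.
  rewrite -mulr_sumr -mulr_suml -/T -{2}(prednK d0) exprS.
  have -> : - mu * (T * L ^+ d.-1) + c * (L * L ^+ d.-1) = (c * L - mu * T) * L ^+ d.-1 by ring.
  have -> : c * L - mu * T = c.
    have cN : c != 0 by rewrite gt_eqF.
    by rewrite /L mulrDr mulr1 (mulrCA c) divff // mulr1 addrK.
  by rewrite mulr_ge0 ?(ltW c0) // exprn_ge0 // (le_trans ler01).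
have [l /andP[l0 _] rl] := poly_ivt (le_trans ler01 L1) (introT andP (conj (ltW Q0) QL)).
exists l; last first.
  by move/rootP: rl; rewrite hornerD hornerN hornerZ => /eqP; rewrite subr_eq0 => /eqP.
rewrite lt_def l0 andbT; apply: contraTneq rl => ->; rewrite rootE.
by rewrite lt_eqF.
Qed.

(** * Entropy of unions of complete bipartite graphs *)

Lemma matching_term_step (R : realFieldType) (d m k : nat) (B : sgraph) (l C : R) :
  balanced B -> regular d B -> #|B| = (2 * m)%N -> (k < m)%N -> 0 < l ->
  (d * m)%:R * l <= C -> m%:R / l <= C ->
  let t j := (num_matchings j B)%:R * l ^+ j in
  t k <= C * t k.+1 /\ t k.+1 <= C * t k.
Proof.
move=> bB rB Bm km l0 C1 C2 t.
have t0 j : 0 <= t j by rewrite mulr_ge0 // exprn_ge0 // ltW.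
split.
  have h : (num_matchings k B <= m * num_matchings k.+1 B)%N.
    by have := num_matchings_le_numS k bB; rewrite Bm; nia.
  apply: (@le_trans _ _ (m%:R / l * t k.+1)); last by rewrite ler_wpM2r.
  have -> : m%:R / l * t k.+1 = (m * num_matchings k.+1 B)%:R * l ^+ k.
    by rewrite /t exprS natrM; have l1 : l != 0 by [rewrite gt_eqF]; field.
  by rewrite ler_wpM2r ?ler_nat // exprn_ge0 // ltW.
have h : (num_matchings k.+1 B <= (d * m) * num_matchings k B)%N.
  by have := num_matchingsS_le k rB; rewrite Bm; nia.
apply: (@le_trans _ _ ((d * m)%:R * l * t k)); last by rewrite ler_wpM2r.
have -> : (d * m)%:R * l * t k = ((d * m) * num_matchings k B)%:R * l ^+ k.+1.
  by rewrite /t exprS natrM; ring.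
by rewrite ler_wpM2r ?ler_nat // exprn_ge0 // ltW.
Qed.

(** Neighbouring terms differ by a factor of at most [C], by the recurrences; the exponent is the
    distance between [k] and [j], written with truncated subtractions. *)
Lemma matching_term_transfer (R : realFieldType) (d m k j : nat) (B : sgraph) (l C : R) :
  balanced B -> regular d B -> #|B| = (2 * m)%N -> (k <= m)%N -> (j <= m)%N -> 0 < l ->
  (d * m)%:R * l <= C -> m%:R / l <= C -> 0 <= C ->
  (num_matchings k B)%:R * l ^+ k <=
  C ^+ ((k - j) + (j - k)) * ((num_matchings j B)%:R * l ^+ j).
Proof.
move=> bB rB Bm km jm l0 C1 C2 C0.
pose t i := (num_matchings i B)%:R * l ^+ i.
have step i (im : (i < m)%N) := matching_term_step bB rB Bm im l0 C1 C2.
have up i r : (i + r <= m)%N -> t i <= C ^+ r * t (i + r)%N.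
  elim: r => [|r IH] ir; first by rewrite expr0 mul1r addn0.
  have ir' : (i + r < m)%N by lia.
  have [h _] := step _ ir'; apply: le_trans (IH _) _; first exact: ltnW.
  by rewrite exprSr -mulrA addnS ler_wpM2l // exprn_ge0.
have down i r : (i + r <= m)%N -> t (i + r)%N <= C ^+ r * t i.
  elim: r => [|r IH] ir; first by rewrite expr0 mul1r addn0.
  have ir' : (i + r < m)%N by lia.
  have [_ h] := step _ ir'; rewrite addnS; apply: le_trans h _.
  by rewrite exprS -mulrA ler_wpM2l // IH // ltnW.
have [kj|jk] := leqP k j.
  have -> : (k - j + (j - k) = j - k)%N by lia.
  by have := up k (j - k)%N; rewrite subnKC //; apply.
have -> : (k - j + (j - k) = k - j)%N by lia.
by have := down j (k - j)%N; rewrite subnKC ?(ltnW jk) //; apply.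
Qed.

(** Taken as a one-copy union so that the results on unions apply directly. *)
Definition Kdd (d : nat) : sgraph := copies 1 (complete_bipartite d).

Lemma card_Kdd (d : nat) : #|Kdd d| = (2 * d)%N.
Proof. by rewrite card_copies_bipartite muln1. Qed.

Lemma matching_poly_copies (R : realType) (d q : nat) :
  (0 < d)%N -> (0 < q)%N ->
  matching_poly R (copies q (complete_bipartite d)) = matching_poly R (Kdd d) ^+ q.
Proof.
move=> d0 q0; apply: (@matching_poly_balanced_exp _ d) => //.
- by rewrite card_Kdd; lia.
- by rewrite card_Kdd card_copies_bipartite.
- exact: copies_bipartite_regular.
- exact: copies_bipartite_regular.
- exact: copies_bipartite_balanced.
- exact: copies_bipartite_balanced.
Qed.

Lemma size_matching_poly_Kdd (R : numDomainType) (d : nat) :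
  size (matching_poly R (Kdd d)) = d.+1.
Proof.
apply/eqP; rewrite eqn_leq size_matching_poly ?card_Kdd //= ltnNge.
apply/negP => /leq_sizeP/(_ d (leqnn d))/eqP.
rewrite coef_matching_poly pnatr_eq0 -leqn0 leqNgt num_matchings_balanced_gt0 //.
  exact: copies_bipartite_balanced.
by rewrite card_Kdd.
Qed.

(** A fourth root is small enough: an index gap of order [n^(1/2)] times [n^(1/4)] is still
    [o(n)]. *)
Lemma ln_le_sqrt_sqrt (R : realType) (x : R) :
  0 < x -> ln x <= 4 * Num.sqrt (Num.sqrt x).
Proof.
move=> x0; have s0 : 0 < Num.sqrt (Num.sqrt x) by rewrite !sqrtr_gt0.
have E : x = Num.sqrt (Num.sqrt x) ^+ 4.
  by rewrite -[4%N]/(2 * 2)%N exprM !sqr_sqrtr // ?sqrtr_ge0 // ltW.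
rewrite {1}E lnXn // -(mulr_natl (ln _)) ler_wpM2l //; apply/ltW/ln_sublinear.
exact: s0.
Qed.

Lemma natr_dist (R : realDomainType) (m n : nat) :
  ((m - n) + (n - m))%:R = `|m%:R - n%:R| :> R.
Proof.
have [mn|/ltnW nm] := leqP m n.
  by rewrite (eqP mn) add0n natrB // distrC ger0_norm // subr_ge0 ler_nat.
by rewrite (eqP nm) addn0 natrB // ger0_norm // subr_ge0 ler_nat.
Qed.

Lemma truncn_dist_le1 (R : archiRealFieldType) (x : R) :
  0 <= x -> `|(Num.truncn x)%:R - x| <= 1.
Proof.
move=> /trunc_itv; rewrite -natr1 => /andP[h1 h2].
by rewrite ler_norml; apply/andP; split; lra.
Qed.

Lemma bipartite_unionE (d q : nat) : (0 < d)%N ->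
  bipartite_union d (2 * d * q) = copies q (complete_bipartite d).
Proof. by move=> d0; rewrite /bipartite_union mulKn //; lia. Qed.

(** The activity gives K_{d,d} mean matching size [2 d rho], below [d] because [rho < 1/2].
    [exists_large_term] finds a heavy term at some [k'] within [O(n^(1/2))] of the overall mean;
    moving to [k] costs [O(n^(3/4))] in the logarithm, hence an error [O(n^(-1/4))] per vertex. *)
Lemma ln_num_matchings_bipartite_ge (R : realType) (d : nat) (rho : R) :
  (0 < d)%N -> 0 < rho -> rho < 2^-1 ->
  exists l K : R, 0 < l /\
  forall q, (0 < q)%N ->
  let n := (2 * d * q)%N in let k := Num.truncn (rho * n%:R) in
  (0 < num_matchings k (bipartite_union d n))%N /\
  ln (matching_poly R (Kdd d)).[l] / (2 * d)%:R - k%:R / n%:R * ln l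
    - K * Num.sqrt (Num.sqrt n%:R^-1) <=
  ln (num_matchings k (bipartite_union d n))%:R / n%:R.
Proof.
move=> d0 r0 rh; set P := matching_poly R (Kdd d).
pose mu := rho * (2 * d)%:R.
have dR : 0 < d%:R :> R by rewrite ltr0n.
have mu0 : 0 < mu by rewrite mulr_gt0 // ltr0n muln_gt0.
have mud : mu < d%:R by rewrite /mu natrM; nra.
have Pk k : 0 <= P`_k by rewrite coef_matching_poly.
have [|l l0 El] := exists_mean_activity (size_matching_poly_Kdd R d) Pk _ mu0 mud.
  by rewrite coef_matching_poly num_matchings0.
have Pl : 0 < P.[l] by rewrite (lt_le_trans ltr01) // matching_poly_ge1 // ltW.
(* Makes [C q] dominate both step ratios of the transfer and the factor [2 (d q + 1)] of the heavy
   term. *)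
pose C := 2 * (d%:R ^+ 2 + 1) * (1 + l + l^-1) :> R.
have li : 0 < l^-1 by rewrite invr_gt0.
have d1 : 1 <= d%:R :> R by rewrite ler1n.
have C0 : 0 < C by rewrite /C mulr_gt0 // ?mulr_gt0 //; nra.
pose r (x : R) := Num.sqrt (Num.sqrt x).
have rM x y : 0 <= x -> r (x * y) = r x * r y.
  by move=> x0; rewrite /r !sqrtrM // sqrtr_ge0.
have alg (a b c e f g h : R) : a != 0 -> c != 0 -> e != 0 ->
    f / e - h / (e * a ^+ 4) * g - b / e * c * (c * a)^-1 =
    (a ^+ 4 * f - h * g - b * a ^+ 3) / (e * a ^+ 4).
  by move=> aN cN eN; field; rewrite aN cN eN.
(* Constant of the product of [|k' - k| + 1 <= (2 d + 2) q^(1/2)] and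
   [ln (C q) <= 4 C^(1/4) q^(1/4)]. *)
pose A := (2 * d%:R + 2) * 4 * r C.
exists l, (A / (2 * d)%:R * r (2 * d)%:R); split => // q q0 n k.
have qR : 1 <= q%:R :> R by rewrite ler1n.
have nE : n%:R = (2 * d)%:R * q%:R :> R by rewrite -natrM.
have nR : 0 < n%:R :> R by rewrite nE mulr_gt0 ?ltr0n ?muln_gt0.
have kdq : (k <= d * q)%N.
  rewrite /k truncn_le_nat nE -natr1 natrM natrM.
  have : 0 < (q%:R : R) by rewrite ltr0n.
  by move=> q1; have := mulr_gt0 dR q1; nra.
rewrite bipartite_unionE //; set H := copies q (complete_bipartite d).
have HP : matching_poly R H = P ^+ q by rewrite matching_poly_copies.
have bH : balanced H := copies_bipartite_balanced q d.
have rH : regular d H := @copies_bipartite_regular q d.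
have Hc : #|H| = (2 * (d * q))%N by rewrite card_copies_bipartite mulnA.
have akp : (0 < num_matchings k H)%N.
  by apply: num_matchings_balanced_gt0; rewrite // Hc leq_mul2l kdq.
split => //.
have Pqk j : 0 <= (P ^+ q)`_j by rewrite -HP coef_matching_poly.
have sP : (size P <= d.+1)%N by rewrite size_matching_poly_Kdd.
have [k' [k'm W Pt]] := exists_large_term d0 q0 sP Pk l0 Pl El Pqk.
rewrite -HP coef_matching_poly in Pt.
have q0R : 0 <= q%:R :> R by [].
have [c1 c2 c3] : [/\ d%:R ^+ 2 * l <= C, d%:R / l <= C & 2 * (d%:R + 1) <= C].
  rewrite /C; have dD : d%:R <= d%:R ^+ 2 :> R by rewrite expr2; nra.
  move: l0 li dD d1; move: (d%:R : R) (d%:R ^+ 2 : R) (l^-1) => e D i l0 i0 eD e1.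
  have := mulr_gt0 l0 i0; have D0 : 0 <= D by lra.
  have := mulr_ge0 D0 (ltW l0); have := mulr_ge0 D0 (ltW i0).
  have h : e * i <= D * i by rewrite ler_wpM2r // ltW.
  by split; lra.
have X1 : (d * (d * q))%:R * l <= C * q%:R.
  by rewrite mulnA natrM natrM -expr2 mulrAC ler_wpM2r.
have X2 : (d * q)%:R / l <= C * q%:R by rewrite natrM mulrAC ler_wpM2r.
have X3 : 2 * (d * q).+1%:R <= C * q%:R.
  apply: (@le_trans _ _ (2 * (d%:R + 1) * q%:R)); last by rewrite ler_wpM2r.
  by rewrite -[(d * q).+1%:R]natr1 natrM; nra.
have X0 : 0 < C * q%:R by rewrite mulr_gt0 // ltr0n.
(* The distance from [k'] to [k]; one further power of [C q] absorbs [2 (d q + 1)]. *)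
pose J := ((k' - k) + (k - k'))%N.
pose t := (num_matchings k H)%:R * l ^+ k.
have t0 : 0 < t by rewrite mulr_gt0 ?exprn_gt0 // ltr0n.
have Pt' : P.[l] ^+ q <= (C * q%:R) ^+ J.+1 * t.
  apply: le_trans Pt _; rewrite [in leRHS]exprS -[leRHS]mulrA.
  have T := matching_term_transfer bH rH Hc k'm kdq l0 X1 X2 (ltW X0).
  apply: (@le_trans _ _ (2 * (d * q).+1%:R * ((C * q%:R) ^+ J * t))).
    by rewrite ler_wpM2l // mulr_ge0.
  by rewrite ler_wpM2r // mulr_ge0 ?exprn_ge0 ?(ltW X0) ?(ltW t0).
have lnPt : q%:R * ln P.[l] <=
    J.+1%:R * ln (C * q%:R) + ln (num_matchings k H)%:R + k%:R * ln l.
  have akR : 0 < (num_matchings k H)%:R :> R by rewrite ltr0n.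
  have lk : 0 < l ^+ k by rewrite exprn_gt0.
  have XJ : 0 < (C * q%:R) ^+ J.+1 by rewrite exprn_gt0.
  have Pq : 0 < P.[l] ^+ q by rewrite exprn_gt0.
  have h : ln (P.[l] ^+ q) <= ln ((C * q%:R) ^+ J.+1 * t).
    by rewrite ler_ln ?posrE // mulr_gt0.
  have h2 : ln ((C * q%:R) ^+ J.+1 * t) = ln ((C * q%:R) ^+ J.+1) + ln t.
    by rewrite lnM ?posrE.
  have h3 : ln t = ln (num_matchings k H)%:R + ln (l ^+ k) by rewrite lnM ?posrE.
  move: h; rewrite h2 h3 (lnXn _ Pl) (lnXn _ X0) (lnXn _ l0).
  by rewrite -(mulr_natl (ln P.[l])) -(mulr_natl (ln (C * _))) -(mulr_natl (ln l)) addrA.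
pose s := r q%:R.
have s0 : 0 < s by rewrite /s /r !sqrtr_gt0 ltr0n.
have s2 : Num.sqrt q%:R = s ^+ 2 :> R by rewrite sqr_sqrtr // sqrtr_ge0.
have s4 : q%:R = s ^+ 4 :> R by rewrite -[4%N]/(2 * 2)%N exprM -s2 sqr_sqrtr.
have s1 : 1 <= s by rewrite -(@ler_pXn2r _ 4) ?nnegrE ?(ltW s0) // expr1n -s4.
have JW : J%:R <= 2 * d%:R * s ^+ 2 + 1.
  have W' : `|k'%:R - q%:R * mu| <= 2 * d%:R * s ^+ 2.
    rewrite -(@ler_pXn2r _ 2) ?nnegrE ?mulr_ge0 ?exprn_ge0 ?(ltW s0) //.
    rewrite real_normK ?num_real // (le_trans W) // s4 le_eqVlt; apply/orP; left.
    by apply/eqP; ring.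
  have kfl : `|k%:R - q%:R * mu| <= 1.
    have -> : q%:R * mu = rho * n%:R by rewrite nE /mu; ring.
    by apply: truncn_dist_le1; rewrite mulr_ge0 // ltW.
  rewrite natr_dist.
  have -> : k'%:R - k%:R = (k'%:R - q%:R * mu) - (k%:R - q%:R * mu) :> R by ring.
  by apply: le_trans (ler_normB _ _) _; rewrite lerD.
have lnX : ln (C * q%:R) <= 4 * (r C * s).
  by rewrite -rM ?(ltW C0) //; apply: ln_le_sqrt_sqrt.
have rC : 0 <= r C by rewrite sqrtr_ge0.
have JX : J.+1%:R * ln (C * q%:R) <= A * s ^+ 3.
  have s21 : 1 <= s ^+ 2 by rewrite exprn_ege1.
  have h : J.+1%:R <= (2 * d%:R + 2) * s ^+ 2 by rewrite -natr1; lra.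
  apply: (@le_trans _ _ (J.+1%:R * (4 * (r C * s)))); first by rewrite ler_wpM2l.
  have -> : A * s ^+ 3 = (2 * d%:R + 2) * s ^+ 2 * (4 * (r C * s)) by rewrite /A; ring.
  by rewrite ler_wpM2r // !mulr_ge0 // ltW.
have dN : (2 * d)%:R != 0 :> R by rewrite pnatr_eq0 -lt0n muln_gt0.
have rn : r n%:R^-1 = (r (2 * d)%:R * s)^-1.
  have n1 : r n%:R * r n%:R^-1 = 1.
    by rewrite -rM ?(ltW nR) // divff ?gt_eqF // /r !sqrtr1.
  have nn : r n%:R = r (2 * d)%:R * s by rewrite nE rM.
  have rnN : r n%:R != 0 by rewrite gt_eqF // /r !sqrtr_gt0.
  by rewrite -nn -[LHS](mulKf rnN) n1 mulr1.
have rdN : r (2 * d)%:R != 0 by rewrite gt_eqF // /r !sqrtr_gt0 ltr0n muln_gt0.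
rewrite -/(r _) rn nE s4.
have sN : s != 0 by rewrite gt_eqF.
have -> : ln P.[l] / (2 * d)%:R - k%:R / ((2 * d)%:R * s ^+ 4) * ln l -
    A / (2 * d)%:R * r (2 * d)%:R * (r (2 * d)%:R * s)^-1 =
    (s ^+ 4 * ln P.[l] - k%:R * ln l - A * s ^+ 3) / ((2 * d)%:R * s ^+ 4).
  by apply: alg.
rewrite -s4.
rewrite ler_pM2r; first lra.
by rewrite invr_gt0 -nE.
Qed.

(** * Entropy bounds *)

(** Logarithm of one term bounded by the whole polynomial of [G], which in turn is bounded through
    K_{d,d}. *)
Lemma ln_num_matchings_le (R : realType) (d k : nat) (G : sgraph) (l : R) :
  (0 < d)%N -> (0 < #|G|)%N -> regular d G -> 0 < l -> (0 < num_matchings k G)%N ->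
  ln (num_matchings k G)%:R / #|G|%:R <=
  ln (matching_poly R (Kdd d)).[l] / (2 * d)%:R - k%:R / #|G|%:R * ln l.
Proof.
move=> d0 G0 rG l0 mk.
have B0 : (0 < #|Kdd d|)%N by rewrite card_Kdd muln_gt0.
have rB : regular d (Kdd d) := @copies_bipartite_regular 1 d.
have := matching_poly_balanced_le d0 G0 B0 rG rB (copies_bipartite_balanced 1 d) (ltW l0).
have := num_matchings_term_le G k (ltW l0).
have := matching_poly_ge1 G (ltW l0); have := matching_poly_ge1 (Kdd d) (ltW l0).
rewrite card_Kdd; set P := (matching_poly R (Kdd d)).[l].
set Q := (matching_poly R G).[l] => P1 Q1 tQ QP.
have P0 : 0 < P by apply: lt_le_trans P1. have Q0 : 0 < Q by apply: lt_le_trans Q1.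
have mR : 0 < (num_matchings k G)%:R :> R by rewrite ltr0n.
have lk : 0 < l ^+ k by rewrite exprn_gt0.
have h1 : ln (num_matchings k G)%:R + k%:R * ln l <= ln Q.
  rewrite mulr_natl -lnXn // -lnM ?posrE //.
  by rewrite ler_ln ?posrE // mulr_gt0.
have h2 : (2 * d)%:R * ln Q <= #|G|%:R * ln P.
  rewrite !mulr_natl -!lnXn // ler_ln ?posrE //; exact: exprn_gt0.
have nR : 0 < #|G|%:R :> R by rewrite ltr0n.
have dR : 0 < (2 * d)%:R :> R by rewrite ltr0n muln_gt0.
have h3 : ln Q / #|G|%:R <= ln P / (2 * d)%:R.
  by rewrite ler_pdivrMr // mulrAC ler_pdivlMr // mulrC (mulrC (ln P)).
have h4 : (ln (num_matchings k G)%:R + k%:R * ln l) / #|G|%:R <= ln Q / #|G|%:R.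
  by rewrite ler_pM2r // invr_gt0.
have := le_trans h4 h3; rewrite mulrDl (mulrAC k%:R).
by rewrite -lerBrDr.
Qed.

Lemma matching_rate_num (R : realType) (n k : nat) (G : sgraph) :
  (0 < num_matchings k G)%N ->
  matching_rate R n k G = (ln (num_matchings k G)%:R / n%:R)%:E.
Proof. by move=> mk; rewrite /matching_rate lne_EFin ?ltr0n // -EFinM. Qed.

Lemma matching_rate_le (R : realType) (d k : nat) (G : sgraph) (l : R) :
  (0 < d)%N -> (0 < #|G|)%N -> regular d G -> 0 < l ->
  (matching_rate R #|G| k G <=
  (ln (matching_poly R (Kdd d)).[l] / (2 * d)%:R - k%:R / #|G|%:R * ln l)%:E)%E.
Proof.
move=> d0 G0 rG l0; have [mk|mk] := posnP (num_matchings k G).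
  rewrite /matching_rate mk le0_lneNy // gt0_mulNye ?leNye //.
  by rewrite lte_fin invr_gt0 ltr0n.
by rewrite matching_rate_num // lee_fin ln_num_matchings_le.
Qed.

Lemma upper_entropy_le (R : realType) (d : nat) (N : set nat) (G : nat -> sgraph)
    (rho l : R) :
  (0 < d)%N -> (forall n, N n -> (0 < n)%N) -> (forall n, N n -> #|G n| = n) ->
  (forall n, N n -> regular d (G n)) -> 0 < l ->
  (upper_entropy N G rho <=
   (ln (matching_poly R (Kdd d)).[l] / (2 * d)%:R - rho * ln l)%:E)%E.
Proof.
move=> d0 N0 Gc Gr l0; apply: ge_ereal_sup => _ [k /= kn <-].
set a := ln _ / _.
have cv : (a - (k n)%:R / n%:R * ln l : R) @[n --> within N \oo] --> a - rho * ln l.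
  by apply: cvgB; [exact: cvg_cst|apply: cvgM; [exact: kn|exact: cvg_cst]].
apply/lee_addgt0Pr => e e0.
have near : \forall n \near within N \oo, a - (k n)%:R / n%:R * ln l <= a - rho * ln l + e.
  by apply: cvgr_le cv _ _; rewrite ltrDl.
rewrite limf_esupE; apply: ge_ereal_inf.
(* The limsup is an infimum of suprema over filter members; this member is where the bound for [k n]
   exceeds its limit by at most [e]. *)
exists (ereal_sup ((fun n => matching_rate R n (k n) (G n)) @`
   [set n | N n /\ a - (k n)%:R / n%:R * ln l <= a - rho * ln l + e])).
  exists [set n | N n /\ a - (k n)%:R / n%:R * ln l <= a - rho * ln l + e] => //.
  move: near; rewrite /prop_near1 /nbhs /= /within /=; apply: filterS => n h Nn.
  by split => //; apply: h.
apply: ge_ereal_sup => _ [n /= [Nn h] <-].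
have := @matching_rate_le R d (k n) (G n) l d0; rewrite Gc //.
move=> /(_ (N0 _ Nn) (Gr _ Nn) l0) /le_trans; apply.
by rewrite -EFinD lee_fin.
Qed.

(** * Limits along the multiples of [2 d] *)

Lemma bipartite_filter_proper (d : nat) : (0 < d)%N -> ProperFilter (bipartite_filter d).
Proof.
move=> d0; apply: Build_ProperFilter => -[m _ /(_ (2 * d * m)%N)] /=.
by move=> h; apply: h; [rewrite leq_pmull // muln_gt0|rewrite dvdn_mulr].
Qed.

Lemma near_bipartite_filter (d : nat) (Q : nat -> Prop) :
  (forall q, (0 < q)%N -> Q (2 * d * q)%N) -> \forall n \near bipartite_filter d, Q n.
Proof.
move=> HQ; exists 1%N => // n /= n1 /dvdnP[q E]; subst n.
by rewrite mulnC; apply: HQ; move: n1; rewrite muln_gt0 => /andP[].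
Qed.

Lemma cvg_bipartite_filter (R : realType) (d : nat) (u : nat -> R) (a : R) :
  u n @[n --> \oo] --> a -> u n @[n --> bipartite_filter d] --> a.
Proof. by move=> ua; apply: cvg_trans ua; apply: cvg_app; apply: cvg_within. Qed.

Lemma cvg_natr_inv (R : realType) : (n%:R^-1 : R) @[n --> \oo] --> (0 : R).
Proof. by rewrite -cvg_shiftS; exact: cvg_harmonic. Qed.

(** A squeeze: the assumed lower bound and [matching_rate_le] at the same [l] differ by the
    vanishing fourth-root term, and the density of [k] tends to [rho]. *)
Lemma cvg_bipartite_rate (R : realType) (d : nat) (rho l K : R) :
  (0 < d)%N -> 0 <= rho -> 0 < l ->
  (forall q, (0 < q)%N ->
  let n := (2 * d * q)%N in let k := Num.truncn (rho * n%:R) in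
  (0 < num_matchings k (bipartite_union d n))%N /\
  ln (matching_poly R (Kdd d)).[l] / (2 * d)%:R - k%:R / n%:R * ln l
    - K * Num.sqrt (Num.sqrt n%:R^-1) <=
  ln (num_matchings k (bipartite_union d n))%:R / n%:R) ->
  bipartite_rate d rho n @[n --> bipartite_filter d] -->
   (ln (matching_poly R (Kdd d)).[l] / (2 * d)%:R - rho * ln l)%:E.
Proof.
move=> d0 r0 l0 H; set a := ln _ / _.
have FF := bipartite_filter_proper d0.
have ckn : ((Num.truncn (rho * n%:R))%:R / n%:R : R) @[n --> bipartite_filter d] --> rho.
  have inv0 := cvg_bipartite_filter d (@cvg_natr_inv R).
  apply: (@squeeze_cvgr _ _ _ _ (fun n => rho - n%:R^-1) (fun n => rho + n%:R^-1)).
  - apply: near_bipartite_filter => q q0.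
    set n := (2 * d * q)%N; have nR : 0 < n%:R :> R by rewrite ltr0n !muln_gt0 d0.
    have := @truncn_dist_le1 R (rho * n%:R) (mulr_ge0 r0 (ltW nR)).
    rewrite ler_norml => /andP[h1 h2]; apply/andP; split.
      by rewrite ler_pdivlMr // mulrBl mulVf ?gt_eqF //; lra.
    by rewrite ler_pdivrMr // mulrDl mulVf ?gt_eqF //; lra.
  - by rewrite -[X in _ --> X]subr0; apply: cvgB => //; exact: cvg_cst.
  - by rewrite -[X in _ --> X]addr0; apply: cvgD => //; exact: cvg_cst.
have cup : (a - (Num.truncn (rho * n%:R))%:R / n%:R * ln l : R)
    @[n --> bipartite_filter d] --> a - rho * ln l.
  by apply: cvgB; [exact: cvg_cst|apply: cvgM; [exact: ckn|exact: cvg_cst]].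
have csq : (K * Num.sqrt (Num.sqrt n%:R^-1) : R) @[n --> bipartite_filter d] --> 0.
  apply: cvg_bipartite_filter; rewrite -[X in _ --> X](mulr0 K).
  apply: cvgM; first exact: cvg_cst.
  rewrite -(sqrtr0 R) -{1}(sqrtr0 R).
  apply: continuous_cvg; first exact: sqrt_continuous.
  apply: continuous_cvg; first exact: sqrt_continuous.
  exact: cvg_natr_inv.
apply: (@squeeze_cvge _ _ _ R
  (fun n => (a - (Num.truncn (rho * n%:R))%:R / n%:R * ln l
    - K * Num.sqrt (Num.sqrt n%:R^-1))%:E)
  _ (fun n => (a - (Num.truncn (rho * n%:R))%:R / n%:R * ln l)%:E)).
- apply: near_bipartite_filter => q q0; have [mk lo] := H q q0.
  rewrite /bipartite_rate; apply/andP; split.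
    by rewrite matching_rate_num // lee_fin.
  set n := (2 * d * q)%N; set k := Num.truncn _.
  have Bn : #|bipartite_union d n| = n by rewrite bipartite_unionE // card_copies_bipartite.
  have := @matching_rate_le R d k (bipartite_union d n) l d0; rewrite Bn; apply => //.
    by rewrite /n !muln_gt0 d0.
  by rewrite bipartite_unionE //; exact: copies_bipartite_regular.
- apply: cvg_EFin; first by near=> n.
  by rewrite -[X in _ --> X]subr0; apply: cvgB.
- by apply: cvg_EFin; first by near=> n.
Unshelve. all: by end_near. Qed.

(** * The endpoint densities and the conclusion *)

Lemma horner_le_const_term (R : realFieldType) (p : {poly R}) (l : R) :
  (forall k, 0 <= p`_k) -> 0 <= l <= 1 -> p.[l] <= p`_0 + l * p.[1].
Proof.
move=> pk /andP[l0 l1].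
have sp : (size p <= (size p).+1)%N by [].
rewrite (horner_coef_wide l sp) (horner_coef_wide 1 sp) big_ord_recl /= expr0 mulr1.
rewrite lerD2l big_ord_recl /= mulrDr -[leLHS]add0r; apply: lerD.
  by rewrite mulr_ge0 // mulr_ge0 // expr0.
rewrite mulr_sumr; apply: ler_sum => k _.
rewrite expr1n mulr1 mulrC ler_wpM2r //.
by rewrite /bump /= add1n exprS ler_piMr // exprn_ile1.
Qed.

Lemma horner_le_top_term (R : realFieldType) (p : {poly R}) (d : nat) (l : R) :
  (forall k, 0 <= p`_k) -> (size p <= d.+1)%N -> 1 <= l ->
  p.[l] <= (p`_d + p.[1] / l) * l ^+ d.
Proof.
move=> pk sp l1; have l0 : 0 < l by rewrite (lt_le_trans ltr01).
rewrite (horner_coef_wide l sp) (horner_coef_wide 1 sp) !big_ord_recr /= mulrDl addrC lerD2l.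
rewrite mulrDl mulrDl -[leLHS]addr0; apply: lerD; last first.
  by rewrite mulr_ge0 ?exprn_ge0 ?(ltW l0) // divr_ge0 ?(ltW l0) // expr1n mulr1.
rewrite !mulr_suml; apply: ler_sum => k _; rewrite expr1n mulr1 -mulrA ler_wpM2l //.
have -> : l ^+ d = l ^+ (d - k.+1) * (l * l ^+ k) by rewrite -exprS -exprD subnK.
rewrite mulrCA (mulrA l^-1) mulVf ?gt_eqF // mul1r mulrC.
by rewrite ler_peMr ?exprn_ge0 ?(ltW l0) // exprn_ege1.
Qed.

Lemma bipartite_entropyE (R : realType) (d : nat) (rho : R) (a : \bar R) :
  (0 < d)%N -> bipartite_rate d rho n @[n --> bipartite_filter d] --> a ->
  cvg (bipartite_rate d rho n @[n --> bipartite_filter d]) /\ bipartite_entropy d rho = a.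
Proof.
move=> d0 ca; have FF := bipartite_filter_proper d0.
by split; [apply/cvg_ex; exists a|apply: cvg_lim => //; exact: ereal_hausdorff].
Qed.

Lemma matching_poly_Kdd_coef_gt0 (R : numDomainType) (d k : nat) :
  (k <= d)%N -> 1 <= (matching_poly R (Kdd d))`_k.
Proof.
move=> kd; rewrite coef_matching_poly ler1n num_matchings_balanced_gt0 //.
  exact: copies_bipartite_balanced.
by rewrite card_Kdd leq_mul2l kd.
Qed.

(** Perfect matchings are counted by the leading coefficient, which is multiplicative. *)
Lemma num_perfect_matchings_copies (R : realType) (d q : nat) :
  (0 < d)%N -> (0 < q)%N ->
  (num_matchings (d * q) (copies q (complete_bipartite d)))%:R =
  (matching_poly R (Kdd d))`_d ^+ q.
Proof.
move=> d0 q0; rewrite -coef_matching_poly matching_poly_copies //.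
have lc : (matching_poly R (Kdd d))`_d = lead_coef (matching_poly R (Kdd d)).
  by rewrite lead_coefE size_matching_poly_Kdd.
by rewrite lc -lead_coef_exp lead_coefE size_exp size_matching_poly_Kdd.
Qed.

Lemma cvg_bipartite_rate_half (R : realType) (d : nat) :
  (0 < d)%N ->
  bipartite_rate d (2^-1 : R) n @[n --> bipartite_filter d] -->
  (ln (matching_poly R (Kdd d))`_d / (2 * d)%:R)%:E.
Proof.
move=> d0; apply: cvg_near_cst; apply: near_bipartite_filter => q q0.
rewrite /bipartite_rate bipartite_unionE //.
have -> : 2^-1 * (2 * d * q)%:R = (d * q)%:R :> R.
  by rewrite -mulnA natrM mulKf // pnatr_eq0.
rewrite natrK matching_rate_num; last first.
  apply: num_matchings_balanced_gt0; first exact: copies_bipartite_balanced.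
  by rewrite card_copies_bipartite mulnA.
rewrite num_perfect_matchings_copies // lnXn; last first.
  exact: lt_le_trans ltr01 (matching_poly_Kdd_coef_gt0 R (leqnn d)).
have qN : q%:R != 0 :> R by rewrite pnatr_eq0 -lt0n.
have dN : (2 * d)%:R != 0 :> R by rewrite pnatr_eq0 -lt0n muln_gt0.
congr (_%:E); rewrite -(mulr_natl (ln _)) (natrM R (2 * d)%N).
move: (ln _) (q%:R : R) ((2 * d)%:R : R) qN dN => x y z yN zN.
by field; rewrite yN zN.
Qed.

(** The first conjunct makes the [lim] in [bipartite_entropy] a genuine limit rather than a default
    value. *)
Theorem mainTheorem4 (R : realType) (d : nat) (d_ge1 : (1 <= d)%N)
    (N : set nat) (N_pos : forall n, N n -> (0 < n)%N)
    (N_infinite : infinite_set N)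
    (G : nat -> sgraph)
    (G_card : forall n, N n -> #|G n| = n)
    (G_regular : forall n, N n -> regular d (G n))
    (rho : R) (rho_ge0 : 0 <= rho) (rho_le_half : rho <= 2^-1) :
  cvg (bipartite_rate d rho n @[n --> bipartite_filter d]) /\
  (upper_entropy N G rho <= bipartite_entropy d rho)%E.
Proof.
have upper l (l0 : 0 < l) := @upper_entropy_le R d N G rho l d_ge1 N_pos G_card G_regular l0.
have Pk k : 0 <= (matching_poly R (Kdd d))`_k by rewrite coef_matching_poly.
have d2 : 1 <= (2 * d)%:R :> R by rewrite ler1n muln_gt0.
have d2p : 0 < (2 * d)%:R :> R := lt_le_trans ltr01 d2.
pose T := (matching_poly R (Kdd d)).[1].
have T1 : 1 <= T by apply: matching_poly_ge1.
have Ppos l : 0 < l -> 0 < (matching_poly R (Kdd d)).[l].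
  by move=> l0; rewrite (lt_le_trans ltr01) // matching_poly_ge1 // ltW.
have [rho0|rho_gt0] := eqVneq rho 0.
  have [|c ->] := @bipartite_entropyE R d rho 0%E d_ge1.
    apply: cvg_near_cst; apply: near_bipartite_filter => q q0.
    rewrite /bipartite_rate rho0 mul0r truncn0 /matching_rate num_matchings0.
    by rewrite lne1 mul0e.
  split => //; apply/lee_addgt0Pr => e e0; rewrite add0e.
  have eT : 0 < e + T by rewrite addr_gt0 // (lt_le_trans ltr01).
  (* Small enough that [l <= 1] and [l T <= e]. *)
  pose l := e / (e + T); have l0 : 0 < l by rewrite divr_gt0.
  have l1 : l <= 1 by rewrite ler_pdivrMr // mul1r lerDl (le_trans ler01).
  apply: le_trans (upper l l0) _; rewrite lee_fin rho0 mul0r subr0 ler_pdivrMr //.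
  have h : (matching_poly R (Kdd d)).[l] <= 1 + l * T.
    have := @horner_le_const_term R (matching_poly R (Kdd d)) l Pk.
    by rewrite coef_matching_poly num_matchings0 (ltW l0) l1; apply.
  have lT : l * T <= e by rewrite mulrAC ler_pdivrMr // ler_wpM2l ?(ltW e0) // lerDr ltW.
  have h2 : ln (matching_poly R (Kdd d)).[l] <= (matching_poly R (Kdd d)).[l] - 1.
    have := @le_ln1Dx R ((matching_poly R (Kdd d)).[l] - 1); rewrite (addrC 1) subrK; apply.
    by rewrite ltrBrDl addrN Ppos.
  apply: (@le_trans _ _ e); first by lra.
  by rewrite ler_peMr // ltW.
have rho0 : 0 < rho by rewrite lt_def rho_gt0.
have [rhoh|rho_half] := eqVneq rho 2^-1.
  have crate := @cvg_bipartite_rate_half R d d_ge1; rewrite -rhoh in crate.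
  have [c ->] := bipartite_entropyE d_ge1 crate.
  split => //; apply/lee_addgt0Pr => e e0.
  set pd := (matching_poly R (Kdd d))`_d.
  have pd1 : 1 <= pd := matching_poly_Kdd_coef_gt0 R (leqnn d).
  have pd0 : 0 < pd := lt_le_trans ltr01 pd1.
  (* Large enough that [T / l <= e]. *)
  pose l := 1 + T / e.
  have Te : 0 <= T / e by rewrite divr_ge0 ?(ltW e0) // (le_trans ler01).
  have l1 : 1 <= l by rewrite lerDl.
  have l0 : 0 < l := lt_le_trans ltr01 l1.
  have Tl : 0 <= T / l by rewrite divr_ge0 ?(ltW l0) // (le_trans ler01).
  have Tle : T / l <= e.
    by rewrite ler_pdivrMr // /l mulrDr mulr1 mulrCA divff ?gt_eqF // mulr1 lerDr ltW.
  apply: le_trans (upper l l0) _; rewrite -EFinD lee_fin rhoh.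
  have h : (matching_poly R (Kdd d)).[l] <= (pd + T / l) * l ^+ d.
    by apply: horner_le_top_term; rewrite ?size_matching_poly_Kdd.
  have a0 : 0 < pd + T / l by rewrite ltr_wpDr.
  have ld : 0 < l ^+ d by rewrite exprn_gt0.
  have h2 : ln (matching_poly R (Kdd d)).[l] <= ln (pd + T / l) + d%:R * ln l.
    by rewrite mulr_natl -lnXn // -lnM ?posrE // ler_ln ?posrE ?Ppos // mulr_gt0.
  have h3 : ln (pd + T / l) <= ln pd + e.
    have -> : pd + T / l = pd * (1 + T / l / pd).
      by rewrite mulrDr mulr1 mulrCA divff ?gt_eqF // mulr1.
    have x0 : 0 <= T / l / pd by rewrite divr_ge0 // ltW.
    rewrite lnM ?posrE //; last by rewrite ltr_wpDr.
    rewrite lerD2l; apply: le_trans (le_ln1Dx _) _.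
      by rewrite (lt_le_trans _ x0) // ltrN10.
    by rewrite (le_trans _ Tle) // ler_pdivrMr // ler_peMr.
  rewrite lerBlDr ler_pdivrMr // !mulrDl divfK ?gt_eqF //.
  (* At [rho = 1/2] the term [rho * ln l] cancels the factor [l ^+ d] exactly, leaving the top
     coefficient up to the error [e]. *)
  have -> : 2^-1 * ln l * (2 * d)%:R = d%:R * ln l.
    by rewrite natrM mulrAC mulrA mulVf ?mul1r // pnatr_eq0.
  apply: le_trans h2 _; rewrite lerD2r (le_trans h3) // lerD2l.
  by rewrite ler_peMr // ltW.
have rho_lt : rho < 2^-1 by rewrite lt_def eq_sym rho_half.
(* The same activity [l] serves the lower and the upper bound, so their values agree. *)
have [l [K [l0 H]]] := ln_num_matchings_bipartite_ge d_ge1 rho0 rho_lt.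
have [c ->] := bipartite_entropyE d_ge1 (cvg_bipartite_rate d_ge1 rho_ge0 l0 H).
by split => //; apply: upper.
Qed.
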